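(* (Explicit Matsuki decomposition of $\mathrm F_{4(-20)}$.) $$\mathrm F_{4(-20)}=K_\epsilon MAN^+\ \amalg\ K_\epsilon\exp\bigl(-\tfrac{\pi}{2}\tilde A_1^1(1)\bigr)MAN^+,$$ where $K_\epsilon MAN^+=K_\epsilon AN^+$ and $$K_\epsilon\exp\bigl(-\tfrac{\pi}{2}\tilde A_1^1(1)\bigr)MAN^+=\{g\in\mathrm F_{4(-20)}:(gP^-|E_2)=0\}.$$
   Context: Octonions: $\mathbf O$ is the real division algebra of octonions with standard basis $1=e_0,e_1,\dots,e_7$, conjugation $x\mapsto\overline x$, inner product $(x|y)=\mathrm{Re}(x\overline y)$, and $\mathrm{Im}\,\mathbf O=\mathrm{span}_{\mathbb R}(e_1,\dots,e_7)$. Jordan algebra: for $\xi_i\in\mathbb R$, $x_i\in\mathbf O$ let $$h^1(\xi_1,\xi_2,\xi_3;x_1,x_2,x_3)=\begin{pmatrix}\xi_1&\sqrt{-1}x_3&\sqrt{-1}\,\overline{x_2}\\ \sqrt{-1}\,\overline{x_3}&\xi_2&x_1\\ \sqrt{-1}x_2&\overline{x_1}&\xi_3\end{pmatrix}$$ (entries in $\mathbf O\otimes_{\mathbb R}\mathbb C$). $\mathcal J^1$ is the real vector space of all these matrices, with Jordan product $X\circ Y=\frac12(XY+YX)$, trace $\mathrm{tr}(X)=\xi_1+\xi_2+\xi_3$ and bilinear form $(X|Y)=\mathrm{tr}(X\circ Y)=\sum\xi_i\eta_i+2(x_1|y_1)-2(x_2|y_2)-2(x_3|y_3)$. $E_i=h^1(\delta_{i1},\delta_{i2},\delta_{i3};0,0,0)$,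 $P^-=h^1(-1,1,0;0,0,1)$. Group: $\mathrm F_{4(-20)}=\{g\in \mathrm{GL}_{\mathbb R}(\mathcal J^1): g(X\circ Y)=gX\circ gY\}$, with Lie algebra $\mathfrak f_{4(-20)}$; $\exp$ is the exponential of linear maps. Operators in $\mathfrak f_{4(-20)}$: for $a\in\mathbf O$, on $X=h^1(\xi_1,\xi_2,\xi_3;x_1,x_2,x_3)$, $\tilde A_1^1(a)X=h^1(0,2(a|x_1),-2(a|x_1);-(\xi_2-\xi_3)a,-\overline{x_3a},\overline{ax_2})$, $\tilde A_2^1(a)X=h^1(2(a|x_2),0,-2(a|x_2);-\overline{ax_3},-(\xi_3-\xi_1)a,-\overline{x_1a})$, $\tilde A_3^1(a)X=h^1(-2(a|x_3),2(a|x_3),0;\overline{x_2a},\overline{ax_1},-(\xi_1-\xi_2)a)$; for $p\in\mathrm{Im}\,\mathbf O$, $\delta(p)X=h^1(0,0,0;px_1,x_2p,-(px_3+x_3p))$. Put $\mathcal G_1(x)=\tilde A_1^1(x)+\tilde A_2^1(-\overline x)$ and $\mathcal G_2(p)=\tilde A_3^1(-p)-\delta(p)$. Subgroups: $\sigma h^1(\xi_1,\xi_2,\xi_3;x_1,x_2,x_3)=h^1(\xi_1,\xi_2,\xi_3;x_1,-x_2,-x_3)$; $K=\{g\in\mathrm F_{4(-20)}:\sigma g\sigma=g\}$; $A=\{\exp(t\tilde A_3^1(1)):t\in\mathbb R\}$; $M=\{k\in K:k\tilde A_3^1(1)k^{-1}=\tilde A_3^1(1)\}$; $N^+=\{\exp(\mathcal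 G_1(x)+\mathcal G_2(p)):x\in\mathbf O,\ p\in\mathrm{Im}\,\mathbf O\}$; $K_\epsilon=\{g\in\mathrm F_{4(-20)}:gE_2=E_2\}$. *)

(* Defs.v *)
From HB Require Import structures.
From mathcomp Require Import all_boot all_order all_algebra.
From mathcomp Require Import complex.
From mathcomp Require Import all_classical all_reals all_analysis.

Set Implicit Arguments.
Unset Strict Implicit.
Unset Printing Implicit Defensive.

Import Order.TTheory GRing.Theory Num.Theory.
Import numFieldNormedType.Exports.

Local Open Scope classical_set_scope.
Local Open Scope ring_scope.
Local Open Scope complex_scope.

(* Octonions with coefficients in a commutative ring K: for K = R this is O,
   for K = R[i] it is the complexification of O, with its C-linear
   conjugation. Vectors are coordinate rows in the basis e_0, ..., e_7. *)
Notation oct K := 'rV[K]_8.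

Section Octonions.
Variable K : comNzRingType.

Definition cdconj n (x : 'rV[K]_n.+1) : 'rV[K]_n.+1 :=
  \row_k (if k == 0 then x 0 k else - x 0 k).

(* Quaternions in the basis 1, i, j, k. *)
Definition qmul (x y : 'rV[K]_4) : 'rV[K]_4 :=
  let x0 := x 0 (inord 0) in let x1 := x 0 (inord 1) in
  let x2 := x 0 (inord 2) in let x3 := x 0 (inord 3) in
  let y0 := y 0 (inord 0) in let y1 := y 0 (inord 1) in
  let y2 := y 0 (inord 2) in let y3 := y 0 (inord 3) in
  \row_k [:: x0 * y0 - x1 * y1 - x2 * y2 - x3 * y3;
             x0 * y1 + x1 * y0 + x2 * y3 - x3 * y2;
             x0 * y2 - x1 * y3 + x2 * y0 + x3 * y1;
             x0 * y3 + x1 * y2 - x2 * y1 + x3 * y0]`_k.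

Definition oe (i : 'I_8) : oct K := delta_mx 0 i.

Definition oconj (x : oct K) : oct K := cdconj x.

(* Cayley-Dickson doubling of the quaternions H to O = H + H e_4:
   (m + a e_4) (n + b e_4) = (m n - b^* a) + (b m + a n^* ) e_4. *)
Definition omul (x y : oct K) : oct K :=
  let m := @lsubmx K 1 4 4 x in let a := @rsubmx K 1 4 4 x in
  let n := @lsubmx K 1 4 4 y in let b := @rsubmx K 1 4 4 y in
  row_mx (qmul m n - qmul (cdconj b) a) (qmul b m + qmul a (cdconj n)).

Definition oinner (x y : oct K) : K := omul x (oconj y) 0 0.

Definition mulmxo n (X Y : 'M[oct K]_n) : 'M[oct K]_n :=
  \matrix_(i, j) \sum_k omul (X i k) (Y k j).

End Octonions.

(* An element h^1(xi1, xi2, xi3; x1, x2, x3) of J^1 is represented by its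
   parameters, which carry the product topology; h1mx gives the matrix. *)
Notation J1 R := (R * R * R * oct R * oct R * oct R)%type.

Section Jordan.
Variable R : realType.
Local Notation O := (oct R).
Local Notation OC := (oct R[i]).

Definition h1 (xi1 xi2 xi3 : R) (x1 x2 x3 : O) : J1 R :=
  (xi1, xi2, xi3, x1, x2, x3).

Definition h1mx (X : J1 R) : 'M[OC]_3 :=
  let: (xi1, xi2, xi3, x1, x2, x3) := X in
  let r (xi : R) : OC := xi%:C *: oe _ 0 in
  let c (x : O) : OC := map_mx (real_complex R) x in
  let i (x : O) : OC := 'i *: c x in
  \matrix_(a, b)
    nth 0 (nth [::]
      [:: [:: r xi1;        i x3;         i (oconj x2)];
          [:: i (oconj x3); r xi2;        c x1];
          [:: i x2;         c (oconj x1); r xi3]] a) b.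

(* Left inverse of h1mx. *)
Definition mxh1 (Z : 'M[OC]_3) : J1 R :=
  let re (z : OC) : O := map_mx (@complex.Re R) z in
  let im (z : OC) : O := map_mx (@complex.Im R) z in
  let e (k : nat) : 'I_3 := inord k in
  h1 (re (Z (e 0) (e 0)) 0 0) (re (Z (e 1) (e 1)) 0 0)
     (re (Z (e 2) (e 2)) 0 0)
     (re (Z (e 1) (e 2))) (im (Z (e 2) (e 0))) (im (Z (e 0) (e 1))).

Definition jmul_mx (X Y : J1 R) : 'M[OC]_3 :=
  \matrix_(a, b) (2^-1 *: (mulmxo (h1mx X) (h1mx Y) a b +
                           mulmxo (h1mx Y) (h1mx X) a b)).

(* J^1 is closed under the Jordan product: jmul_mx X Y is again of the form
   h^1, so reading off its parameters with mxh1 loses nothing. *)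
Definition jmul (X Y : J1 R) : J1 R := mxh1 (jmul_mx X Y).

Definition jtr (X : J1 R) : R :=
  let: (xi1, xi2, xi3, x1, x2, x3) := X in xi1 + xi2 + xi3.

Definition jform (X Y : J1 R) : R := jtr (jmul X Y).

Definition E2 : J1 R := h1 0 1 0 0 0 0.
Definition Pminus : J1 R := h1 (-1) 1 0 0 0 (oe _ 0).

(* Operator exponential; on the finite-dimensional space J^1 the series
   converges in norm, so its sum can be computed pointwise. *)
Definition expJ (T : J1 R -> J1 R) (X : J1 R) : J1 R :=
  limn (series (fun k => k`!%:R^-1 *: iter k T X)).

Definition F4 : set (J1 R -> J1 R) :=
  [set g | [/\ linear g, bijective g &
    forall X Y, g (jmul X Y) = jmul (g X) (g Y)]].

(* At1, At2, At3 are \tilde A_1^1, \tilde A_2^1, \tilde A_3^1. *)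
Definition At1 (a : O) (X : J1 R) : J1 R :=
  let: (xi1, xi2, xi3, x1, x2, x3) := X in
  h1 0 (2 * oinner a x1) (- 2 * oinner a x1)
     (- (xi2 - xi3) *: a) (- oconj (omul x3 a)) (oconj (omul a x2)).

Definition At2 (a : O) (X : J1 R) : J1 R :=
  let: (xi1, xi2, xi3, x1, x2, x3) := X in
  h1 (2 * oinner a x2) 0 (- 2 * oinner a x2)
     (- oconj (omul a x3)) (- (xi3 - xi1) *: a) (- oconj (omul x1 a)).

Definition At3 (a : O) (X : J1 R) : J1 R :=
  let: (xi1, xi2, xi3, x1, x2, x3) := X in
  h1 (- 2 * oinner a x3) (2 * oinner a x3) 0
     (oconj (omul x2 a)) (oconj (omul a x1)) (- (xi1 - xi2) *: a).

Definition delta (p : O) (X : J1 R) : J1 R :=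
  let: (xi1, xi2, xi3, x1, x2, x3) := X in
  h1 0 0 0 (omul p x1) (omul x2 p) (- (omul p x3 + omul x3 p)).

Definition G1 (x : O) : J1 R -> J1 R := At1 x \+ At2 (- oconj x).
Definition G2 (p : O) : J1 R -> J1 R := At3 (- p) \- delta p.

Definition sigma (X : J1 R) : J1 R :=
  let: (xi1, xi2, xi3, x1, x2, x3) := X in h1 xi1 xi2 xi3 x1 (- x2) (- x3).

Definition Ksub : set (J1 R -> J1 R) := [set g | F4 g /\ sigma \o g \o sigma = g].

Definition Asub : set (J1 R -> J1 R) :=
  [set expJ (t *: At3 (oe _ 0)) | t in [set: R]].

Definition Msub : set (J1 R -> J1 R) :=
  [set k | Ksub k /\ exists k' : J1 R -> J1 R,
    [/\ cancel k k', cancel k' k & k \o At3 (oe _ 0) \o k' = At3 (oe _ 0)]].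

Definition ImO : {vspace O} := <<[seq oe R i | i in predC1 ord0]>>%VS.

Definition Nplus : set (J1 R -> J1 R) :=
  [set expJ (G1 x \+ G2 p) | x in [set: O] & p in [set` ImO]].

Definition Keps : set (J1 R -> J1 R) := [set g | F4 g /\ g E2 = E2].

(* Elementwise product of subsets of the group. *)
Definition setcomp (S T : set (J1 R -> J1 R)) : set (J1 R -> J1 R) :=
  [set g \o h | g in S & h in T].

End Jordan.

Arguments E2 : clear implicits.
Arguments Pminus : clear implicits.
Arguments F4 : clear implicits.
Arguments Asub : clear implicits.
Arguments Msub : clear implicits.
Arguments Nplus : clear implicits.
Arguments Keps : clear implicits.

Notation "S <o> T" := (setcomp S T) (at level 40, left associativity)
  : classical_set_scope.

(* Main.v *)
Require Import Defs.
From HB Require Import structures.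
From mathcomp Require Import all_boot all_order all_algebra.
From mathcomp Require Import complex ring lra.
From mathcomp Require Import all_classical all_reals all_analysis.

Set Implicit Arguments.
Unset Strict Implicit.
Unset Printing Implicit Defensive.

Import Order.TTheory GRing.Theory Num.Theory.
Import numFieldNormedType.Exports.
Local Open Scope classical_set_scope.
Local Open Scope ring_scope.

(* [g] lies in one of the two pieces according to the value of
   [(g P^- | E_2) = (P^- | Y)], where [Y = g^-1 E_2] is an idempotent of trace 1.
   Automorphisms preserve the trace because the trace-free elements are sums of
   associators, and [(g P^- | E_2) >= 0] because [(P^- | Z^2) = |z_1 - conj z_2|^2]
   as soon as [(P^- | Z) = 0].  The subgroup [M A N^+] scales [P^-] by positive
   factors, [K_eps] fixes [E_2] and [w = exp (-(pi/2) At1 1)] maps [P^-] to an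
   element orthogonal to [E_2], so the value is positive on [K_eps M A N^+] and
   zero on [K_eps w M A N^+].  Conversely, if it is positive then [N^+] kills the
   weight -1 and 0 parts of [Y] and [A] moves the result to [E_2]; if it is zero
   then [Y = exp (G x 0) E_3] for some [x], and [w E_3 = E_2]. *)

(** The passage from [g] to [Y = g^-1 E_2] is forced by the left factor: [g] lies in [K_eps h]
    exactly when [g^-1 E_2 = h^-1 E_2], so the decomposition is a statement about orbits of
    idempotents. These are read through the grading of [J1 R] by the eigenvalues -2, ..., 2 of
    [At3 1]. The operators in the Lie algebra of [N^+] raise the weight by 1 (parameter [x]) or 2
    (parameter [p]), and [P^-] spans the top weight, so pairing with [P^-] reads off the weight -2
    part of [Y]. Membership of the exponentials in the group never requires multiplying infinite
    series: on [N^+] the series are finite, [At3 1] is diagonalisable, and the exponential defining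
    [w] is computed explicitly by plane rotations. Positivity also enters for [M]: commuting with
    [At3 1] and [sigma] only gives [m P^- = P^-] or [m P^- = - P^-], and the sign is decided by
    positivity. Octonion identities are checked in coordinates; for the derivation property this is
    affordable only after the triple products have been removed by the alternative laws. *)

Ltac row8_cases := apply/rowP=> -[[|[|[|[|[|[|[|[|//]]]]]]]] lt_k].

(** * Octonion arithmetic in coordinates *)

Section OctonionCoordinates.
Variable K : comNzRingType.

(** In this form an octonion identity becomes eight polynomial identities for [ring]. The
    coefficient ring stays arbitrary because both [R] and [R[i]] occur. *)
Definition row8 (x0 x1 x2 x3 x4 x5 x6 x7 : K) : oct K :=
  \row_k [:: x0; x1; x2; x3; x4; x5; x6; x7]`_k.

Lemma row8E (x : oct K) : exists x0 x1 x2 x3 x4 x5 x6 x7,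
  x = row8 x0 x1 x2 x3 x4 x5 x6 x7.
Proof.
exists (x 0 (inord 0)), (x 0 (inord 1)), (x 0 (inord 2)), (x 0 (inord 3)),
  (x 0 (inord 4)), (x 0 (inord 5)), (x 0 (inord 6)), (x 0 (inord 7)).
apply/rowP=> k; rewrite mxE.
by case: k => [[|[|[|[|[|[|[|[|//]]]]]]]] lt_k] /=;
  congr (x _ _); apply/val_inj; rewrite /= inordK.
Qed.

Lemma omul_row8 x0 x1 x2 x3 x4 x5 x6 x7 y0 y1 y2 y3 y4 y5 y6 y7 :
  omul (row8 x0 x1 x2 x3 x4 x5 x6 x7) (row8 y0 y1 y2 y3 y4 y5 y6 y7) = row8
   (x0*y0 - x1*y1 - x2*y2 - x3*y3 - x4*y4 - x5*y5 - x6*y6 - x7*y7)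
   (x0*y1 + x1*y0 + x2*y3 - x3*y2 - x5*y4 + x4*y5 + x7*y6 - x6*y7)
   (x0*y2 - x1*y3 + x2*y0 + x3*y1 - x6*y4 - x7*y5 + x4*y6 + x5*y7)
   (x0*y3 + x1*y2 - x2*y1 + x3*y0 - x7*y4 + x6*y5 - x5*y6 + x4*y7)
   (y4*x0 - y5*x1 - y6*x2 - y7*x3 + x4*y0 + x5*y1 + x6*y2 + x7*y3)
   (y4*x1 + y5*x0 + y6*x3 - y7*x2 - x4*y1 + x5*y0 - x6*y3 + x7*y2)
   (y4*x2 - y5*x3 + y6*x0 + y7*x1 - x4*y2 + x5*y3 + x6*y0 - x7*y1)
   (y4*x3 + y5*x2 - y6*x1 + y7*x0 - x4*y3 - x5*y2 + x6*y1 + x7*y0).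
Proof.
have inordE n (lt_n : (n < 4)%N) : inord n = Ordinal lt_n :> 'I_4.
  by apply: val_inj; rewrite /= inordK.
have l4 i (lt4 : (i < 8)%N) (h : (i < 4)%N) :
  fintype.split (Ordinal lt4 : 'I_(4 + 4)) = inl (Ordinal h).
  case: splitP => j /= ej; last by have := h; rewrite [X in (X < _)%N]ej ltnNge leq_addr.
  by congr inl; apply: val_inj.
have r4 i (lt4 : (4 + i < 8)%N) (h : (i < 4)%N) :
  fintype.split (Ordinal lt4 : 'I_(4 + 4)) = inr (Ordinal h).
  case: splitP => j /= ej; first by have := ltn_ord j; rewrite -ej ltnNge leq_addr.
  by congr inr; apply: val_inj; apply/eqP; rewrite -(eqn_add2l 4) /= ej.
pose inordEs := (inordE 0%N isT, inordE 1%N isT, inordE 2%N isT, inordE 3%N isT).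
row8_cases; rewrite /omul mxE;
 [rewrite (@l4 0%N _ isT)|rewrite (@l4 1%N _ isT)|rewrite (@l4 2%N _ isT)
 |rewrite (@l4 3%N _ isT)|rewrite (@r4 0%N _ isT)|rewrite (@r4 1%N _ isT)
 |rewrite (@r4 2%N _ isT)|rewrite (@r4 3%N _ isT)];
 rewrite /qmul /cdconj ![in LHS]mxE /= !inordEs !mxE /=; ring.
Qed.

Lemma oconj_row8 x0 x1 x2 x3 x4 x5 x6 x7 :
  oconj (row8 x0 x1 x2 x3 x4 x5 x6 x7) =
  row8 x0 (- x1) (- x2) (- x3) (- x4) (- x5) (- x6) (- x7).
Proof. by row8_cases; rewrite !mxE. Qed.

Lemma addr_row8 x0 x1 x2 x3 x4 x5 x6 x7 y0 y1 y2 y3 y4 y5 y6 y7 :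
  row8 x0 x1 x2 x3 x4 x5 x6 x7 + row8 y0 y1 y2 y3 y4 y5 y6 y7 =
  row8 (x0 + y0) (x1 + y1) (x2 + y2) (x3 + y3)
       (x4 + y4) (x5 + y5) (x6 + y6) (x7 + y7).
Proof. by row8_cases; rewrite !mxE. Qed.

Lemma oppr_row8 x0 x1 x2 x3 x4 x5 x6 x7 :
  - row8 x0 x1 x2 x3 x4 x5 x6 x7 =
  row8 (- x0) (- x1) (- x2) (- x3) (- x4) (- x5) (- x6) (- x7).
Proof. by row8_cases; rewrite !mxE. Qed.

Lemma scaler_row8 k x0 x1 x2 x3 x4 x5 x6 x7 :
  k *: row8 x0 x1 x2 x3 x4 x5 x6 x7 =
  row8 (k * x0) (k * x1) (k * x2) (k * x3) (k * x4) (k * x5) (k * x6) (k * x7).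
Proof. by row8_cases; rewrite !mxE. Qed.

Lemma row8_0 : 0 = row8 0 0 0 0 0 0 0 0.
Proof. by row8_cases; rewrite !mxE. Qed.

Lemma oe0_row8 : oe K 0 = row8 1 0 0 0 0 0 0 0.
Proof. by row8_cases; rewrite !mxE. Qed.

Lemma row8_re x0 x1 x2 x3 x4 x5 x6 x7 :
  row8 x0 x1 x2 x3 x4 x5 x6 x7 0 0 = x0.
Proof. by rewrite mxE. Qed.

Lemma oinner_row8 x0 x1 x2 x3 x4 x5 x6 x7 y0 y1 y2 y3 y4 y5 y6 y7 :
  oinner (row8 x0 x1 x2 x3 x4 x5 x6 x7) (row8 y0 y1 y2 y3 y4 y5 y6 y7) =
  x0*y0 + x1*y1 + x2*y2 + x3*y3 + x4*y4 + x5*y5 + x6*y6 + x7*y7.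
Proof. by rewrite /oinner oconj_row8 omul_row8 row8_re; ring. Qed.

Definition row8_simp := (row8_0, oe0_row8, oconj_row8, addr_row8, oppr_row8,
  scaler_row8, omul_row8, oinner_row8, row8_re).

End OctonionCoordinates.

Ltac row8_elim x :=
  have [?[?[?[?[?[?[?[? ->]]]]]]]] := row8E x.
Ltac row8_all := repeat match goal with x : 'rV[_]_8 |- _ =>
  (row8_elim x; clear x) || clear x end.
Ltac row8_ring := rewrite ?row8_simp; try (congr row8); ring.

Lemma map_row8 (K L : comNzRingType) (f : {rmorphism K -> L})
    x0 x1 x2 x3 x4 x5 x6 x7 :
  map_mx f (row8 x0 x1 x2 x3 x4 x5 x6 x7) =
  row8 (f x0) (f x1) (f x2) (f x3) (f x4) (f x5) (f x6) (f x7).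
Proof. by row8_cases; rewrite !mxE. Qed.

Lemma map_omul (K L : comNzRingType) (f : {rmorphism K -> L}) (x y : oct K) :
  map_mx f (omul x y) = omul (map_mx f x) (map_mx f y).
Proof.
by row8_elim x; row8_elim y; rewrite !(row8_simp, map_row8); congr row8; ring.
Qed.

Section OctonionAlgebra.
Variable K : comNzRingType.
Implicit Types x y z : oct K.

Lemma oconjK : involutive (@oconj K).
Proof. by move=> x; row8_elim x; row8_ring. Qed.

Lemma omulZ k l x y : omul (k *: x) (l *: y) = (k * l) *: omul x y.
Proof. by row8_elim x; row8_elim y; row8_ring. Qed.

Lemma omulZl k x y : omul (k *: x) y = k *: omul x y.
Proof. by row8_elim x; row8_elim y; row8_ring. Qed.

Lemma omulZr k x y : omul x (k *: y) = k *: omul x y.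
Proof. by row8_elim x; row8_elim y; row8_ring. Qed.

Lemma omulDl x y z : omul (x + y) z = omul x z + omul y z.
Proof. by row8_elim x; row8_elim y; row8_elim z; row8_ring. Qed.

Lemma omulDr x y z : omul x (y + z) = omul x y + omul x z.
Proof. by row8_elim x; row8_elim y; row8_elim z; row8_ring. Qed.

Lemma omul1o x : omul (oe K 0) x = x.
Proof. by row8_elim x; row8_ring. Qed.

Lemma omulo1 x : omul x (oe K 0) = x.
Proof. by row8_elim x; row8_ring. Qed.

Lemma omul0o x : omul 0 x = 0.
Proof. by row8_elim x; row8_ring. Qed.

Lemma omulo0 x : omul x 0 = 0.
Proof. by row8_elim x; row8_ring. Qed.

Lemma oconj0 : oconj 0 = 0 :> oct K.
Proof. by row8_ring. Qed.

Lemma oinner0o x : oinner 0 x = 0.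
Proof. by row8_elim x; row8_ring. Qed.

Lemma oinnero0 x : oinner x 0 = 0.
Proof. by row8_elim x; row8_ring. Qed.

Lemma oconj1 : oconj (oe K 0) = oe K 0.
Proof. by row8_ring. Qed.

Lemma oinner11 : oinner (oe K 0) (oe K 0) = 1.
Proof. by row8_ring. Qed.

Definition oct0_simp := (omul0o, omulo0, oconj0, oinner0o, oinnero0, oconj1,
  oinner11, omul1o, omulo1, @scaler0 K (oct K), @scale0r K (oct K), @scale1r K (oct K),
  @addr0 (oct K), @add0r (oct K), @oppr0 (oct K), @oppr0 K,
  @addr0 K, @add0r K, @mulr0 K, @mul0r K, @mulr1 K, @mul1r K).

Lemma oconjD x y : oconj (x + y) = oconj x + oconj y.
Proof. by row8_elim x; row8_elim y; row8_ring. Qed.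

Lemma oconjN x : oconj (- x) = - oconj x.
Proof. by row8_elim x; row8_ring. Qed.

Lemma oconjZ k x : oconj (k *: x) = k *: oconj x.
Proof. by row8_elim x; row8_ring. Qed.

Lemma omulNl x y : omul (- x) y = - omul x y.
Proof. by row8_elim x; row8_elim y; row8_ring. Qed.

Lemma omulNr x y : omul x (- y) = - omul x y.
Proof. by row8_elim x; row8_elim y; row8_ring. Qed.

Definition oct_expand := (oconjD, oconjN, oconjZ, omulDl, omulDr,
  omulZl, omulZr, omulNl, omulNr, oconjK).

(** As conjugation reverses products, the left side is [conj x (x a)], so this is the left
    alternative law; the next lemma is the right one. *)
Lemma omul_oconjl x a : oconj (omul (oconj (omul x a)) x) = oinner x x *: a.
Proof. by row8_elim x; row8_elim a; row8_ring. Qed.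

Lemma omul_oconjr x a : oconj (omul x (oconj (omul a x))) = oinner x x *: a.
Proof. by row8_elim x; row8_elim a; row8_ring. Qed.

(** Linearised alternative law: [conj a (x y) + conj x (a y) = 2 (a|x) y]. The form is the one in
    which the Leibniz rule for [At1], [At2] and [At3] calls for it. *)
Lemma omul_polarl a x y :
  oconj (omul (oconj (omul x y)) a) =
  (2 * oinner a x) *: y - oconj (omul (oconj (omul a y)) x).
Proof. by row8_elim a; row8_elim x; row8_elim y; row8_ring. Qed.

Lemma omul_polarr a x y :
  oconj (omul a (oconj (omul y x))) =
  (2 * oinner a x) *: y - oconj (omul x (oconj (omul y a))).
Proof. by row8_elim a; row8_elim x; row8_elim y; row8_ring. Qed.

Variable p : oct K.
Hypothesis p0 : p 0 0 = 0.

(** Because [conj p = - p], conjugating the three identities gives in turn the linearised right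
    alternative law [(xy)p + (xp)y = x(yp + py)], its left counterpart, and the cyclic symmetry of
    the associator. They are what makes [delta p] a derivation. *)
Lemma omul_im_l x y : omul p (oconj (omul x y)) =
  oconj (omul (omul x p) y) - oconj (omul x (omul p y)) - oconj (omul x (omul y p)).
Proof.
by move: p0; row8_elim p; rewrite row8_re => ->; row8_elim x; row8_elim y; row8_ring.
Qed.

Lemma omul_im_r x y : omul (oconj (omul y x)) p =
  oconj (omul y (omul p x)) - oconj (omul (omul p y) x) - oconj (omul (omul y p) x).
Proof.
by move: p0; row8_elim p; rewrite row8_re => ->; row8_elim x; row8_elim y; row8_ring.
Qed.

Lemma omul_im_lr x y : omul p (oconj (omul x y)) = - omul (oconj (omul x y)) p
  - oconj (omul (omul p x) y) - oconj (omul x (omul y p)).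
Proof.
by move: p0; row8_elim p; rewrite row8_re => ->; row8_elim x; row8_elim y; row8_ring.
Qed.

End OctonionAlgebra.

Lemma h1_eq (R : realType) (a1 a2 a3 b1 b2 b3 : R) (x1 x2 x3 y1 y2 y3 : oct R) :
  a1 = b1 -> a2 = b2 -> a3 = b3 -> x1 = y1 -> x2 = y2 -> x3 = y3 ->
  h1 a1 a2 a3 x1 x2 x3 = h1 b1 b2 b3 y1 y2 y3.
Proof. by do 6!move=> ->. Qed.

(** * The Jordan product in real parameters *)

Section JordanProduct.
Variable R : realType.
Local Notation O := (oct R).
Local Notation C := R[i].
Local Notation c := (map_mx (real_complex R)).
Implicit Types x y z : O.

(* Twice the Jordan product, which avoids denominators. *)
Definition jmul2 (X Y : J1 R) : J1 R :=
  let: (a1, a2, a3, x1, x2, x3) := X in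
  let: (b1, b2, b3, y1, y2, y3) := Y in
  h1 (2 * (a1 * b1 - oinner x2 y2 - oinner x3 y3))
     (2 * (a2 * b2 + oinner x1 y1 - oinner x3 y3))
     (2 * (a3 * b3 + oinner x1 y1 - oinner x2 y2))
     ((a2 + a3) *: y1 + (b2 + b3) *: x1 - oconj (omul x2 y3 + omul y2 x3))
     ((a3 + a1) *: y2 + (b3 + b1) *: x2 + oconj (omul y3 x1 + omul x3 y1))
     ((a1 + a2) *: y3 + (b1 + b2) *: x3 + oconj (omul y1 x2 + omul x1 y2)).

Lemma h1Z (k a1 a2 a3 : R) x1 x2 x3 :
  k *: h1 a1 a2 a3 x1 x2 x3 = h1 (k * a1) (k * a2) (k * a3) (k *: x1) (k *: x2) (k *: x3).
Proof. by []. Qed.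

(** Every matrix entry is of one of these two kinds, and a product of two entries is again of one of
    them; hence the matrix product can be computed with real octonions only. *)
Definition cx (x : O) : oct C := c x.
Definition ix (x : O) : oct C := 'i *: c x.

Lemma re_cx x : map_mx (@complex.Re R) (2^-1 *: cx x) = 2^-1 *: x.
Proof.
have -> : 2^-1 *: cx x = c (2^-1 *: x).
  by rewrite map_mxZ /= fmorphV rmorph_nat.
by apply/rowP=> i; rewrite !mxE.
Qed.

Lemma im_ix x : map_mx (@complex.Im R) (2^-1 *: ix x) = 2^-1 *: x.
Proof.
have -> : 2^-1 *: ix x = 'i *: c (2^-1 *: x).
  by rewrite map_mxZ /= fmorphV rmorph_nat !scalerA mulrC.
by apply/rowP=> i; rewrite !mxE -complexiE /= mul0r mul1r add0r.
Qed.

Lemma cxD x y : cx x + cx y = cx (x + y).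
Proof. by rewrite /cx map_mxD. Qed.

Lemma ixD x y : ix x + ix y = ix (x + y).
Proof. by rewrite /ix map_mxD scalerDr. Qed.

Lemma omul_cx_cx x y : omul (cx x) (cx y) = cx (omul x y).
Proof. by rewrite /cx map_omul. Qed.

Lemma omul_cx_ix x y : omul (cx x) (ix y) = ix (omul x y).
Proof. by rewrite /ix omulZr -/(cx x) omul_cx_cx. Qed.

Lemma omul_ix_cx x y : omul (ix x) (cx y) = ix (omul x y).
Proof. by rewrite /ix omulZl -/(cx x) omul_cx_cx. Qed.

Lemma omul_ix_ix x y : omul (ix x) (ix y) = cx (- omul x y).
Proof.
by rewrite /ix omulZ -!/(cx _) omul_cx_cx -expr2 sqrCi scaleN1r /cx map_mxN.
Qed.

Definition h1mx_entry (X : J1 R) (a b : nat) : oct C :=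
  let: (a1, a2, a3, x1, x2, x3) := X in
  nth 0 (nth [::]
    [:: [:: cx (a1 *: oe R 0); ix x3; ix (oconj x2)];
        [:: ix (oconj x3); cx (a2 *: oe R 0); cx x1];
        [:: ix x2; cx (oconj x1); cx (a3 *: oe R 0)]] a) b.

Lemma h1mxE X (a b : 'I_3) : h1mx X a b = h1mx_entry X a b.
Proof.
have r k : (real_complex R k) *: oe C 0 = cx (k *: oe R 0).
  by rewrite /cx map_mxZ /= !oe0_row8 map_row8 !rmorph0 rmorph1.
by case: X => [[[[[a1 a2] a3] x1] x2] x3]; rewrite mxE !r.
Qed.

Definition mulmxo_entry (X Y : J1 R) (a b : nat) : oct C :=
  omul (h1mx_entry X a 0) (h1mx_entry Y 0 b) +
  omul (h1mx_entry X a 1) (h1mx_entry Y 1 b) +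
  omul (h1mx_entry X a 2) (h1mx_entry Y 2 b).

Lemma jmul_mxE X Y (a b : nat) : (a < 3)%N -> (b < 3)%N ->
  jmul_mx X Y (inord a) (inord b) =
  2^-1 *: (mulmxo_entry X Y a b + mulmxo_entry Y X a b).
Proof.
move=> lt_a lt_b; rewrite /jmul_mx mxE /mulmxo.
have sum3 (F : nat -> oct C) :
    \sum_(k < 3) F k = F 0%N + F 1%N + F 2%N.
  by rewrite !big_ord_recl big_ord0 addr0 addrA.
have mulmxoE (A B : J1 R) :
    \sum_k omul (h1mx A (inord a) k) (h1mx B k (inord b)) = mulmxo_entry A B a b.
  apply: etrans (sum3 (fun k => omul (h1mx_entry A a k) (h1mx_entry B k b))).
  by apply: eq_bigr => k _; rewrite !h1mxE !inordK.
by congr (_ *: (_ + _)); rewrite mxE mulmxoE.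
Qed.

Lemma jmulE X Y : jmul X Y = 2^-1 *: jmul2 X Y.
Proof.
rewrite /jmul /mxh1 !jmul_mxE //.
case: X => [[[[[a1 a2] a3] x1] x2] x3]; case: Y => [[[[[b1 b2] b3] y1] y2] y3].
rewrite /mulmxo_entry /h1mx_entry; cbn [nth].
(* With the two embeddings and the complex product made opaque, only their multiplication and
   addition rules remain, and no complex coordinates are ever expanded. *)
move: cx ix (@omul C) omul_cx_cx omul_cx_ix omul_ix_cx omul_ix_ix cxD ixD re_cx im_ix.
move=> c i m cc ci ic ii cD iD re im.
rewrite [RHS]h1Z.
by apply: h1_eq; rewrite !(cc, ci, ic, ii) !(cD, iD) !(re, im); row8_all; row8_ring.
Qed.

End JordanProduct.

Section TraceForm.
Variable R : realType.

(** Associativity of the trace form, the source of the vanishing of the trace on associators. *)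
Lemma jtr_assoc (X Y Z : J1 R) :
  jtr (jmul2 (jmul2 X Y) Z) = jtr (jmul2 X (jmul2 Y Z)).
Proof.
case: X => [[[[[a1 a2] a3] x1] x2] x3]; case: Y => [[[[[b1 b2] b3] y1] y2] y3].
case: Z => [[[[[c1 c2] c3] z1] z2] z3].
rewrite /jmul2 /jtr /h1; cbn beta iota zeta.
row8_elim x1; row8_elim x2; row8_elim x3.
row8_elim y1; row8_elim y2; row8_elim y3.
row8_elim z1; row8_elim z2; row8_elim z3.
by rewrite !row8_simp; ring.
Qed.

End TraceForm.

Section Linearity.
Variable R : realType.
Implicit Types (X Y Z : J1 R) (x y z : oct R) (k : R).

Lemma oinnerP (a : oct R) k x y : oinner a (k *: x + y) = k * oinner a x + oinner a y.
Proof. by row8_elim a; row8_elim x; row8_elim y; row8_ring. Qed.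

Lemma oinnerC x y : oinner x y = oinner y x.
Proof. by row8_elim x; row8_elim y; row8_ring. Qed.

Lemma J1P (P : J1 R -> Prop) :
  (forall a1 a2 a3 x1 x2 x3, P (h1 a1 a2 a3 x1 x2 x3)) -> forall X, P X.
Proof. by move=> Ph [[[[[a1 a2] a3] x1] x2] x3]; apply: Ph. Qed.

Section Coordinates.
Variables (a1 a2 a3 b1 b2 b3 k : R) (x1 x2 x3 y1 y2 y3 a : oct R).

Lemma h1D : h1 a1 a2 a3 x1 x2 x3 + h1 b1 b2 b3 y1 y2 y3 =
  h1 (a1 + b1) (a2 + b2) (a3 + b3) (x1 + y1) (x2 + y2) (x3 + y3).
Proof. by []. Qed.

Lemma h1N : - h1 a1 a2 a3 x1 x2 x3 =
  h1 (- a1) (- a2) (- a3) (- x1) (- x2) (- x3).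
Proof. by []. Qed.

Lemma jmul2E : jmul2 (h1 a1 a2 a3 x1 x2 x3) (h1 b1 b2 b3 y1 y2 y3) =
  h1 (2 * (a1 * b1 - oinner x2 y2 - oinner x3 y3))
     (2 * (a2 * b2 + oinner x1 y1 - oinner x3 y3))
     (2 * (a3 * b3 + oinner x1 y1 - oinner x2 y2))
     ((a2 + a3) *: y1 + (b2 + b3) *: x1 - oconj (omul x2 y3 + omul y2 x3))
     ((a3 + a1) *: y2 + (b3 + b1) *: x2 + oconj (omul y3 x1 + omul x3 y1))
     ((a1 + a2) *: y3 + (b1 + b2) *: x3 + oconj (omul y1 x2 + omul x1 y2)).
Proof. by []. Qed.

Lemma At1E : At1 a (h1 a1 a2 a3 x1 x2 x3) =
  h1 0 (2 * oinner a x1) (- 2 * oinner a x1)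
     (- (a2 - a3) *: a) (- oconj (omul x3 a)) (oconj (omul a x2)).
Proof. by []. Qed.

Lemma At2E : At2 a (h1 a1 a2 a3 x1 x2 x3) =
  h1 (2 * oinner a x2) 0 (- 2 * oinner a x2)
     (- oconj (omul a x3)) (- (a3 - a1) *: a) (- oconj (omul x1 a)).
Proof. by []. Qed.

Lemma At3E : At3 a (h1 a1 a2 a3 x1 x2 x3) =
  h1 (- 2 * oinner a x3) (2 * oinner a x3) 0
     (oconj (omul x2 a)) (oconj (omul a x1)) (- (a1 - a2) *: a).
Proof. by []. Qed.

Lemma deltaE : delta a (h1 a1 a2 a3 x1 x2 x3) =
  h1 0 0 0 (omul a x1) (omul x2 a) (- (omul a x3 + omul x3 a)).
Proof. by []. Qed.

Lemma sigmaE : sigma (h1 a1 a2 a3 x1 x2 x3) = h1 a1 a2 a3 x1 (- x2) (- x3).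
Proof. by []. Qed.

Lemma jtrE : jtr (h1 a1 a2 a3 x1 x2 x3) = a1 + a2 + a3.
Proof. by []. Qed.

End Coordinates.

Lemma jmul2C X Y : jmul2 X Y = jmul2 Y X.
Proof.
elim/J1P: X => *; elim/J1P: Y => *; rewrite !jmul2E.
by apply: h1_eq; row8_all; row8_ring.
Qed.

(* The order of the rewriting steps matters: unification would accept any
   element of [J1 R] as an instance of [h1 ...]. *)
Ltac J1_linear E :=
  let X := fresh in let Y := fresh in move=> ? X Y; elim/J1P: X => *; elim/J1P: Y => *;
  rewrite h1Z h1D !E h1Z h1D; apply: h1_eq; row8_all; row8_ring.

Lemma At1_linear (a : oct R) : linear (At1 a).
Proof. by J1_linear At1E. Qed.

Lemma At2_linear (a : oct R) : linear (At2 a).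
Proof. by J1_linear At2E. Qed.

Lemma At3_linear (a : oct R) : linear (At3 a).
Proof. by J1_linear At3E. Qed.

Lemma delta_linear (a : oct R) : linear (delta a).
Proof. by J1_linear deltaE. Qed.

Lemma jmul2_linear X : linear (jmul2 X).
Proof. by elim/J1P: X => *; J1_linear jmul2E. Qed.

End Linearity.

(* For maps whose linearity is a hypothesis, as in [F4]. *)
Section LinearFacts.
Variables (R : nzRingType) (U V : lmodType R).

Lemma linear_0 (f : U -> V) : linear f -> f 0 = 0.
Proof. by move=> lf; have := lf (-1) 0 0; rewrite scaler0 addr0 scaleN1r addNr. Qed.

Lemma linear_D (f : U -> V) X Y : linear f -> f (X + Y) = f X + f Y.
Proof. by move=> lf; have := lf 1 X Y; rewrite !scale1r. Qed.

Lemma linear_Z (f : U -> V) k X : linear f -> f (k *: X) = k *: f X.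
Proof. by move=> lf; have := lf k X 0; rewrite linear_0 // !addr0. Qed.

Lemma linear_N (f : U -> V) X : linear f -> f (- X) = - f X.
Proof. by move=> lf; rewrite -scaleN1r linear_Z // scaleN1r. Qed.

Lemma linear_B (f : U -> V) X Y : linear f -> f (X - Y) = f X - f Y.
Proof. by move=> lf; rewrite linear_D // linear_N. Qed.

Lemma linear_sum (f : U -> V) I r (P : pred I) F : linear f ->
  f (\sum_(i <- r | P i) F i) = \sum_(i <- r | P i) f (F i).
Proof.
by move=> lf; apply: (big_morph f) => [X Y|]; [apply: linear_D | apply: linear_0].
Qed.

End LinearFacts.

(** Polarisation: the hypothesis at [X + Y], minus those at [X] and [Y], is twice the Leibniz rule.
    Testing only squares halves the number of octonion variables in the derivation checks. *)
Lemma polarized_derivation (K : numFieldType) (V : lmodType K) (B : V -> V -> V) (D : V -> V) :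
  (forall X Y, B X Y = B Y X) -> (forall X, linear (B X)) -> linear D ->
  (forall X, D (B X X) = 2 *: B (D X) X) ->
  forall X Y, D (B X Y) = B (D X) Y + B X (D Y).
Proof.
move=> BC lB lD DB X Y.
have BD A A' A'' : B A (A' + A'') = B A A' + B A A''.
  exact: linear_D (lB A).
have BDl A A' A'' : B (A + A') A'' = B A A'' + B A' A''.
  by rewrite 3!(BC _ A'') BD.
have two0 : (2 : K) != 0 by rewrite pnatr_eq0.
have sq : B (X + Y) (X + Y) = (B X X + B Y Y) + 2 *: B X Y.
  by rewrite BD !BDl (BC Y X) scaler_nat mulr2n (AC (2*2) ((1*4)*(2*3)))%AC.
have := DB (X + Y); rewrite sq (linear_D _ _ lD) (linear_Z _ _ lD).
rewrite (linear_D (B X X) (B Y Y) lD) !DB (linear_D X Y lD) BD !BDl.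
rewrite [X in _ = 2 *: X -> _](AC (2*2) ((1*4)*(3*2)))%AC -scalerDr.
rewrite [X in _ = X -> _]scalerDr => /addrI.
by move/(scalerI two0) ->; rewrite [B X _]BC.
Qed.

(** * The operators of the Lie algebra are derivations *)

Section JordanSquare.
Variable R : realType.
Implicit Types (X Y : J1 R) (a p x y : oct R).

Definition jsqr (X : J1 R) : J1 R :=
  let: (a1, a2, a3, x1, x2, x3) := X in
  h1 (a1 * a1 - oinner x2 x2 - oinner x3 x3)
     (a2 * a2 + oinner x1 x1 - oinner x3 x3)
     (a3 * a3 + oinner x1 x1 - oinner x2 x2)
     ((a2 + a3) *: x1 - oconj (omul x2 x3))
     ((a3 + a1) *: x2 + oconj (omul x3 x1))
     ((a1 + a2) *: x3 + oconj (omul x1 x2)).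

Lemma jsqrE (a1 a2 a3 : R) x1 x2 x3 : jsqr (h1 a1 a2 a3 x1 x2 x3) =
  h1 (a1 * a1 - oinner x2 x2 - oinner x3 x3)
     (a2 * a2 + oinner x1 x1 - oinner x3 x3)
     (a3 * a3 + oinner x1 x1 - oinner x2 x2)
     ((a2 + a3) *: x1 - oconj (omul x2 x3))
     ((a3 + a1) *: x2 + oconj (omul x3 x1))
     ((a1 + a2) *: x3 + oconj (omul x1 x2)).
Proof. by []. Qed.

Lemma jmul2_sqr X : jmul2 X X = 2 *: jsqr X.
Proof.
elim/J1P: X => a1 a2 a3 x1 x2 x3; rewrite jmul2E jsqrE h1Z.
by apply: h1_eq => //; move: (omul _ _) => y; row8_all; row8_ring.
Qed.

Lemma derivation_jsqr (D : J1 R -> J1 R) : linear D ->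
  (forall X, D (jsqr X) = jmul2 (D X) X) ->
  forall X Y, D (jmul2 X Y) = jmul2 (D X) Y + jmul2 X (D Y).
Proof.
move=> lD Dsqr; apply: (polarized_derivation (@jmul2C R) (@jmul2_linear R) lD) => X.
by rewrite jmul2_sqr (linear_Z _ _ lD) Dsqr.
Qed.

Ltac generalize_products := repeat match goal with
  | |- context [oconj (omul ?x ?y)] => generalize (oconj (omul x y)); intro
  | |- context [omul ?x ?y] => generalize (omul x y); intro
  | |- context [oinner ?x ?y] => generalize (oinner x y); intro
  end.

(* Once the quadratic products are abstracted, [e] reduces the goal to a
   linear identity. *)
Ltac octonion_linear e :=
  rewrite ?oct_expand; generalize e; generalize_products; move=> ->; row8_all; row8_ring.

Ltac octonion_linear2 e1 e2 :=
  rewrite ?oct_expand; generalize e1 e2; generalize_products; move=> -> ->;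
  row8_all; row8_ring.

Lemma At1_jmul2 a X Y : At1 a (jmul2 X Y) = jmul2 (At1 a X) Y + jmul2 X (At1 a Y).
Proof.
apply: derivation_jsqr; first exact: At1_linear.
move=> {Y} {}X; elim/J1P: X => a1 a2 a3 x1 x2 x3; rewrite jsqrE !At1E jmul2E.
apply: h1_eq.
1-3: by row8_all; row8_ring.
- by octonion_linear2 (omul_oconjl x3 a) (omul_oconjr x2 a).
- by octonion_linear (omul_polarl a x1 x2).
- by octonion_linear (omul_polarr a x1 x3).
Qed.

Lemma At2_jmul2 a X Y : At2 a (jmul2 X Y) = jmul2 (At2 a X) Y + jmul2 X (At2 a Y).
Proof.
apply: derivation_jsqr; first exact: At2_linear.
move=> {Y} {}X; elim/J1P: X => a1 a2 a3 x1 x2 x3; rewrite jsqrE !At2E jmul2E.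
apply: h1_eq.
1-3: by row8_all; row8_ring.
- by octonion_linear (omul_polarr a x2 x1).
- by octonion_linear2 (omul_oconjr x3 a) (omul_oconjl x1 a).
- by octonion_linear (omul_polarl a x2 x3).
Qed.

Lemma At3_jmul2 a X Y : At3 a (jmul2 X Y) = jmul2 (At3 a X) Y + jmul2 X (At3 a Y).
Proof.
apply: derivation_jsqr; first exact: At3_linear.
move=> {Y} {}X; elim/J1P: X => a1 a2 a3 x1 x2 x3; rewrite jsqrE !At3E jmul2E.
apply: h1_eq.
1-3: by row8_all; row8_ring.
- by octonion_linear (omul_polarl a x3 x1).
- by octonion_linear (omul_polarr a x3 x2).
- by octonion_linear2 (omul_oconjr x1 a) (omul_oconjl x2 a).
Qed.

Lemma delta_jmul2 p X Y : p 0 0 = 0 ->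
  delta p (jmul2 X Y) = jmul2 (delta p X) Y + jmul2 X (delta p Y).
Proof.
move=> p0; apply: derivation_jsqr; first exact: delta_linear.
move=> {Y} {}X; elim/J1P: X => a1 a2 a3 x1 x2 x3; rewrite jsqrE !deltaE jmul2E.
apply: h1_eq.
1-3: by move: p0; row8_elim p; rewrite row8_re => ->; row8_all; row8_ring.
- by octonion_linear (omul_im_l p0 x2 x3).
- by octonion_linear (omul_im_r p0 x1 x3).
- by octonion_linear (omul_im_lr p0 x1 x2).
Qed.

End JordanSquare.

(** * Exponentials of derivations: nilpotent case and convergence *)

Section NilpotentExponential.
Variable R : numFieldType.

Definition texp (V : lmodType R) (D : V -> V) m X : V :=
  \sum_(k < m) k`!%:R^-1 *: iter k D X.

Variables (U V W : lmodType R) (B : U -> V -> W).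
Hypotheses (B_linl : forall y, linear (B^~ y)) (B_linr : forall x, linear (B x)).
Variables (DU : U -> U) (DV : V -> V) (DW : W -> W).
Hypotheses (DW_lin : linear DW)
  (leibniz : forall x y, DW (B x y) = B (DU x) y + B x (DV y)).

Let F x y i j : W := B (i`!%:R^-1 *: iter i DU x) (j`!%:R^-1 *: iter j DV y).

Lemma iter_leibniz k x y :
  k`!%:R^-1 *: iter k DW (B x y) = \sum_(i < k.+1) F x y i (k - i).
Proof.
have FE i j : F x y i j = (i`!%:R^-1 * j`!%:R^-1) *: B (iter i DU x) (iter j DV y).
  by rewrite /F (linear_Z _ _ (B_linl _)) (linear_Z _ _ (B_linr _)) scalerA.
have fS n : (n.+1%:R : R) * (n.+1)`!%:R^-1 = n`!%:R^-1.
  by rewrite factS natrM invfM mulrA mulfV ?pnatr_eq0 // mul1r.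
elim: k => [|k IHk]; first by rewrite big_ord1 FE subn0 /= fact0 invr1 mulr1.
have k1 : (k.+1%:R : R) != 0 by rewrite pnatr_eq0.
apply: (scalerI k1); rewrite scalerA fS iterS -(linear_Z _ _ DW_lin) IHk.
rewrite (linear_sum _ _ _ DW_lin) scaler_sumr.
(* The factor [k.+1] is split as [i + (k.+1 - i)]. The first part collects the terms where the new
   derivative falls on [x], the second those where it falls on [y]; the factorials absorb the
   binomial coefficients. *)
have -> : \sum_(i < k.+2) k.+1%:R *: F x y i (k.+1 - i) =
   \sum_(i < k.+2) i%:R *: F x y i (k.+1 - i) +
   \sum_(i < k.+2) (k.+1 - i)%:R *: F x y i (k.+1 - i).
  rewrite -big_split /=; apply: eq_bigr => i _.
  by rewrite -scalerDl -natrD subnKC // -ltnS.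
rewrite [X in _ = X + _]big_ord_recl /= mulr0n scale0r add0r.
rewrite [X in _ = _ + X]big_ord_recr /= subnn mulr0n scale0r addr0.
rewrite -big_split /=; apply: eq_bigr => i _.
rewrite /bump /= add1n subSS subSn -1?ltnS // !FE !scalerA.
rewrite (linear_Z _ _ DW_lin) leibniz scalerDr.
by congr (_ *: _ + _ *: _); [rewrite mulrA fS | rewrite mulrCA fS].
Qed.

(** Expanding the left side by [iter_leibniz] gives the sum of [F x y i j] over the triangle
    [i + j < m + m]. It contains the square [i, j < m], and outside this square all terms vanish by
    nilpotency. *)
Lemma texp_mul m x y : iter m DU x = 0 -> iter m DV y = 0 ->
    DU 0 = 0 -> DV 0 = 0 ->
  texp DW (m + m) (B x y) = B (texp DU m x) (texp DV m y).
Proof.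
move=> DUm DVm DU0 DV0.
have iter0 (T : lmodType R) (D : T -> T) z i :
    D 0 = 0 -> iter m D z = 0 -> (m <= i)%N -> iter i D z = 0.
  move=> D0 Dm /subnK <-; rewrite iterD Dm.
  by elim: (i - m)%N => //= j ->.
have F0l i j : (m <= i)%N -> F x y i j = 0.
  by move=> le_mi; rewrite /F (iter0 _ DU) // scaler0 (linear_0 (B_linl _)).
have F0r i j : (m <= j)%N -> F x y i j = 0.
  by move=> le_mj; rewrite /F (iter0 _ DV) // scaler0 (linear_0 (B_linr _)).
transitivity (\sum_(0 <= i < m) \sum_(0 <= j < m) F x y i j); last first.
  rewrite /texp (linear_sum _ _ _ (B_linl _)) big_mkord; apply: eq_bigr => i _.
  by rewrite (linear_sum _ _ _ (B_linr _)) big_mkord.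
have cut (G : nat -> W) n : (m <= n)%N -> (forall i, (m <= i)%N -> G i = 0) ->
    \sum_(0 <= i < n) G i = \sum_(0 <= i < m) G i.
  move=> le_mn G0; rewrite (big_cat_nat _ le_mn) //= [X in _ + X]big_nat_cond.
  by rewrite [X in _ + X]big1 ?addr0 // => i /andP[/andP[/G0]].
rewrite /texp -(big_mkord xpredT (fun k => k`!%:R^-1 *: iter k DW (B x y))).
transitivity (\sum_(0 <= k < m + m)
    \sum_(0 <= i < m + m | (i <= k)%N) F x y i (k - i)).
  apply: eq_big_nat => k lt_k; rewrite iter_leibniz.
  by rewrite -(big_mkord xpredT (fun i => F x y i (k - i))) (big_nat_widen _ _ (m + m)).
rewrite (exchange_big_dep_nat xpredT) //=.
transitivity (\sum_(0 <= i < m + m) \sum_(0 <= j < m + m - i) F x y i j).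
  apply: eq_bigr => i _.
  transitivity (\sum_(i <= k < m + m) F x y i (k - i)).
    by rewrite [RHS](@big_nat_widenl _ _ _ i 0).
  by rewrite -{1}(add0n i) big_addn; apply: eq_bigr => j _; rewrite addnK.
rewrite cut ?leq_addr // => [|i le_mi]; last by rewrite big1 // => j _; apply: F0l.
apply: eq_big_nat => i /andP[_ lt_im]; apply: cut => [|j]; last exact: F0r.
by rewrite -addnBA ?leq_addr // ltnW.
Qed.

End NilpotentExponential.

Section OperatorExponential.
Variables (R : realType) (V : normedModType R).
Implicit Types (T : V -> V) (X Y : V).

(** [expJ] takes a limit that means nothing for a divergent series, so convergence is carried along.
    As a relation it is additive in [X], which allows an exponential to be computed on summands. *)
Definition exp_to T X Y :=
  series (fun k => k`!%:R^-1 *: iter k T X) n @[n --> \oo] --> Y.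

Lemma exp_toD T X1 X2 Y1 Y2 : linear T ->
  exp_to T X1 Y1 -> exp_to T X2 Y2 -> exp_to T (X1 + X2) (Y1 + Y2).
Proof.
move=> lT h1 h2; rewrite /exp_to.
have iterP k : iter k T (X1 + X2) = iter k T X1 + iter k T X2.
  by elim: k => //= k ->; rewrite (linear_D _ _ lT).
have -> : (fun k => k`!%:R^-1 *: iter k T (X1 + X2)) =
  (fun k => k`!%:R^-1 *: iter k T X1) + (fun k => k`!%:R^-1 *: iter k T X2).
  by apply/funext => k; rewrite iterP scalerDr.
by rewrite seriesD; apply: cvgD.
Qed.

Lemma exp_to_eigen T X (l : R) : linear T -> T X = l *: X ->
  exp_to T X (expR l *: X).
Proof.
move=> lT TX; rewrite /exp_to.
have iterE k : iter k T X = l ^+ k *: X.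
  by elim: k => [|k /= ->]; rewrite ?expr0 ?scale1r // (linear_Z _ _ lT) TX scalerA exprSr.
have -> : series (fun k => k`!%:R^-1 *: iter k T X) =
  (fun n => series (exp_coeff l) n *: X).
  apply/funext => n; rewrite /series /= scaler_suml; apply: eq_bigr => k _.
  by rewrite iterE scalerA /exp_coeff /= mulrC.
by apply: cvgZr_tmp; exact: is_cvg_series_exp_coeff.
Qed.

(** On the span of [X] and [T X] the operator is [w] times a complex structure: even powers sum to
    the cosine series, odd ones to the sine series, where one factor [w] is already contained in
    [T X]. *)
Lemma exp_to_rotation T X (w : R) : linear T -> w != 0 ->
  T (T X) = - w ^+ 2 *: X ->
  exp_to T X (cos w *: X + (sin w / w) *: T X).
Proof.
move=> lT w0 TTX; rewrite /exp_to.
have iterE k : k`!%:R^-1 *: iter k T X =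
    cos_coeff w k *: X + (sin_coeff w k / w) *: T X.
  have iter2 j : iter j.*2 T X = (- w ^+ 2) ^+ j *: X.
    elim: j => [|j IH]; first by rewrite expr0 scale1r.
    by rewrite doubleS !iterS IH !(linear_Z _ _ lT) TTX scalerA [in RHS](exprSr (- w ^+ 2)).
  rewrite -(odd_double_half k) /cos_coeff /sin_coeff; move: k./2 => j.
  case: (odd k); rewrite ?(add0n, add1n) /= odd_double /= ?doubleK.
    rewrite !mul0r scale0r add0r iter2 (linear_Z _ _ lT) scalerA mul1r.
    rewrite [w ^+ j.*2.+1]exprS -(mul2n j) exprM -[- w ^+ 2]mulN1r exprMn; congr (_ *: _).
    by field; rewrite w0 pnatr_eq0 -lt0n fact_gt0.
  rewrite !mul0r scale0r addr0 iter2 scalerA mul1r.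
  rewrite -(mul2n j) exprM -[- w ^+ 2]mulN1r exprMn; congr (_ *: _).
  by rewrite mulrC.
have -> : series (fun k => k`!%:R^-1 *: iter k T X) =
  (fun n => series (cos_coeff w) n *: X + (series (sin_coeff w) n / w) *: T X).
  apply/funext => n; rewrite /series /= mulr_suml !scaler_suml -big_split /=.
  by apply: eq_bigr => k _; rewrite iterE.
rewrite cos.unlock sin.unlock.
apply: cvgD; apply: cvgZr_tmp; first exact: is_cvg_series_cos_coeff.
by apply: cvgMr_tmp; exact: is_cvg_series_sin_coeff.
Qed.

Lemma exp_to_nilpotent T X m : T 0 = 0 -> iter m T X = 0 -> exp_to T X (texp T m X).
Proof.
move=> T0 Tm; apply: cvg_near_cst; exists m => // n /= le_mn.
rewrite /series /texp /= (big_cat_nat _ le_mn) //= big_mkord.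
rewrite [X in _ + X]big_nat_cond [X in _ + X]big1 ?addr0 // => i /andP[/andP[le_mi _] _].
rewrite -(subnK le_mi) iterD Tm (_ : iter _ _ _ = 0) ?scaler0 //.
by elim: (_ - _)%N => //= j ->.
Qed.

End OperatorExponential.

Lemma exp_toE (R : realType) (T : J1 R -> J1 R) X Y : exp_to T X Y -> expJ T X = Y.
Proof. exact: cvg_lim. Qed.

Ltac J1_compute := rewrite jmul2E; apply: h1_eq;
  rewrite ?oct0_simp ?subr0 //; try ring; row8_all; row8_ring.

Lemma linear_comb0 (R : nzRingType) (U V : lmodType R) (f : U -> V) k r s A B C D E F :
  linear f -> f B = 0 -> f C = 0 -> f D = 0 -> f E = 0 -> f F = 0 ->
  f (k *: A + B + C + D + r *: E + s *: F) = k *: f A.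
Proof.
move=> lf fB fC fD fE fF; do 5 rewrite (linear_D _ _ lf).
by rewrite !(linear_Z _ _ lf) fB fC fD fE fF !scaler0 !addr0.
Qed.

(** * Automorphisms preserve the trace and the bilinear form *)

Section AutomorphismGroup.
Variable R : realType.
Implicit Types (g h : J1 R -> J1 R) (X Y Z : J1 R).

Lemma jform_jmul2 X Y : jform X Y = 2^-1 * jtr (jmul2 X Y).
Proof.
rewrite /jform jmulE; elim/J1P: (jmul2 X Y) => *.
by rewrite h1Z !jtrE !mulrDr.
Qed.

Lemma jformE (a1 a2 a3 b1 b2 b3 : R) (x1 x2 x3 y1 y2 y3 : oct R) :
  jform (h1 a1 a2 a3 x1 x2 x3) (h1 b1 b2 b3 y1 y2 y3) =
  a1 * b1 + a2 * b2 + a3 * b3 +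
  2 * (oinner x1 y1 - oinner x2 y2 - oinner x3 y3).
Proof.
rewrite jform_jmul2 jmul2E jtrE.
move: (oinner x1 y1) (oinner x2 y2) (oinner x3 y3) => r1 r2 r3; by field.
Qed.

Lemma F4_linear g : F4 R g -> linear g.
Proof. by case. Qed.

Lemma F4_jmul2 g X Y : F4 R g -> g (jmul2 X Y) = jmul2 (g X) (g Y).
Proof.
move=> [lg _ gM]; have := gM X Y; rewrite !jmulE (linear_Z _ _ lg).
by apply: scalerI; rewrite invr_neq0 // pnatr_eq0.
Qed.

Lemma F4_intro g h : linear g -> cancel g h -> cancel h g ->
  (forall X Y, g (jmul2 X Y) = jmul2 (g X) (g Y)) -> F4 R g.
Proof.
move=> lg gK hK gM; split; [exact: lg | by exists h | move=> X Y].
by rewrite !jmulE (linear_Z _ _ lg) gM.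
Qed.

Lemma F4_id : F4 R id.
Proof. exact: (@F4_intro id id). Qed.

Lemma F4_comp g h : F4 R g -> F4 R h -> F4 R (g \o h).
Proof.
move=> [lg [g' gK g'K] gM] [lh [h' hK h'K] hM]; split.
- by move=> k X Y /=; rewrite lh lg.
- by exists (h' \o g'); [exact: can_comp | exact: can_comp].
- by move=> X Y /=; rewrite hM gM.
Qed.

Lemma F4_inv g h : F4 R g -> cancel g h -> cancel h g -> F4 R h.
Proof.
move=> [lg _ gM] gK hK; split.
- by move=> k X Y; apply: (can_inj gK); rewrite lg !hK.
- by exists g.
- by move=> X Y; apply: (can_inj gK); rewrite gM !hK.
Qed.

Lemma F4_inverse g : F4 R g -> exists h, [/\ F4 R h, cancel g h & cancel h g].
Proof.
move=> Fg; have [_ [h gK hK] _] := Fg; exists h.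
by split; first exact: F4_inv Fg gK hK.
Qed.

(** Four times the associator of the Jordan product, since each [jmul2] contributes a factor 2. *)
Definition assoc2 X Y Z := jmul2 (jmul2 X Y) Z - jmul2 X (jmul2 Y Z).

Lemma jtr_linear X Y k : jtr (k *: X + Y) = k * jtr X + jtr Y.
Proof.
by elim/J1P: X => *; elim/J1P: Y => *; rewrite h1Z h1D !jtrE; ring.
Qed.

Lemma jtr_assoc2 X Y Z : jtr (assoc2 X Y Z) = 0.
Proof.
by rewrite /assoc2 addrC -scaleN1r jtr_linear jtr_assoc mulN1r addNr.
Qed.

Lemma F4_assoc2 g X Y Z : F4 R g -> g (assoc2 X Y Z) = assoc2 (g X) (g Y) (g Z).
Proof.
move=> Fg; rewrite /assoc2 (linear_B _ _ (F4_linear Fg)).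
by rewrite !(F4_jmul2 _ _ Fg).
Qed.

Definition Jone : J1 R := h1 1 1 1 0 0 0.

Lemma jmul2_Jone X : jmul2 Jone X = 2 *: X.
Proof.
elim/J1P: X => *; rewrite /Jone jmul2E h1Z.
by apply: h1_eq; row8_all; row8_ring.
Qed.

Lemma F4_Jone g : F4 R g -> g Jone = Jone.
Proof.
move=> Fg; have [h [_ _ hK]] := F4_inverse Fg.
have e X : jmul2 (g Jone) X = 2 *: X.
  by rewrite -[X]hK -(F4_jmul2 _ _ Fg) jmul2_Jone (linear_Z _ _ (F4_linear Fg)).
have two0 : (2 : R) != 0 by rewrite pnatr_eq0.
by apply: (scalerI two0); rewrite -jmul2_Jone jmul2C e.
Qed.

Let e1 : J1 R := h1 1 0 0 0 0 0.
Let e2 : J1 R := h1 0 1 0 0 0 0.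
Let f1 x : J1 R := h1 0 0 0 x 0 0.
Let f2 x : J1 R := h1 0 0 0 0 x 0.
Let f3 x : J1 R := h1 0 0 0 0 0 x.
Let one := oe R 0.

(* Modulo scalars the algebra is spanned by associators, on which the trace
   vanishes. *)
Lemma associator_decomposition X : exists r s,
  X = (jtr X / 3) *: Jone + assoc2 e2 e2 (f1 (X.1.1.2)) + assoc2 e1 e1 (f2 (X.1.2))
     + assoc2 e1 e1 (f3 X.2) + r *: assoc2 (f3 one) (f3 one) e1
     + s *: assoc2 (f1 one) (f1 one) e2.
Proof.
elim/J1P: X => a1 a2 a3 x1 x2 x3.
have A1 x : assoc2 e2 e2 (f1 x) = f1 x.
  have p : jmul2 e2 e2 = h1 0 2 0 0 0 0 by J1_compute.
  have q : jmul2 e2 (f1 x) = f1 x by J1_compute.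
  have r : jmul2 (h1 0 2 0 0 0 0) (f1 x) = h1 0 0 0 (2 *: x) 0 0 by J1_compute.
  by rewrite /assoc2 p !q r /f1 h1N h1D !subr0 scaler_nat mulr2n addrK.
have A2 x : assoc2 e1 e1 (f2 x) = f2 x.
  have p : jmul2 e1 e1 = h1 2 0 0 0 0 0 by J1_compute.
  have q : jmul2 e1 (f2 x) = f2 x by J1_compute.
  have r : jmul2 (h1 2 0 0 0 0 0) (f2 x) = h1 0 0 0 0 (2 *: x) 0 by J1_compute.
  by rewrite /assoc2 p !q r /f2 h1N h1D !subr0 scaler_nat mulr2n addrK.
have A3 x : assoc2 e1 e1 (f3 x) = f3 x.
  have p : jmul2 e1 e1 = h1 2 0 0 0 0 0 by J1_compute.
  have q : jmul2 e1 (f3 x) = f3 x by J1_compute.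
  have r : jmul2 (h1 2 0 0 0 0 0) (f3 x) = h1 0 0 0 0 0 (2 *: x) by J1_compute.
  by rewrite /assoc2 p !q r /f3 h1N h1D !subr0 scaler_nat mulr2n addrK.
have B1 : assoc2 (f3 one) (f3 one) e1 = h1 (-2) 2 0 0 0 0.
  have p : jmul2 (f3 one) (f3 one) = h1 (-2) (-2) 0 0 0 0 by J1_compute.
  have q : jmul2 (f3 one) e1 = f3 one by J1_compute.
  have r : jmul2 (h1 (-2) (-2) 0 0 0 0) e1 = h1 (-4) 0 0 0 0 0 by J1_compute.
  rewrite /assoc2 p !q ?p r h1N h1D; apply: h1_eq; rewrite ?subr0 //; ring.
have B2 : assoc2 (f1 one) (f1 one) e2 = h1 0 2 (-2) 0 0 0.
  have p : jmul2 (f1 one) (f1 one) = h1 0 2 2 0 0 0 by J1_compute.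
  have q : jmul2 (f1 one) e2 = f1 one by J1_compute.
  have r : jmul2 (h1 0 2 2 0 0 0) e2 = h1 0 4 0 0 0 0 by J1_compute.
  rewrite /assoc2 p !q ?p r h1N h1D; apply: h1_eq; rewrite ?subr0 //; ring.
rewrite A1 A2 A3 B1 B2 jtrE /Jone /f1 /f2 /f3.
set t := (a1 + a2 + a3) / 3.
(* The diagonal of the right side is [t - 2r], [t + 2r + 2s], [t - 2s]. The outer entries determine
   [r] and [s]; the middle one then agrees because [3t] is the trace. *)
exists ((t - a1) / 2), ((t - a3) / 2).
transitivity (h1 (t * 1 + 0 + 0 + 0 + (t - a1) / 2 * (-2) + (t - a3) / 2 * 0)
  (t * 1 + 0 + 0 + 0 + (t - a1) / 2 * 2 + (t - a3) / 2 * 2)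
  (t * 1 + 0 + 0 + 0 + (t - a1) / 2 * 0 + (t - a3) / 2 * (-2))
  (t *: 0 + x1 + 0 + 0 + ((t - a1) / 2) *: 0 + ((t - a3) / 2) *: 0)
  (t *: 0 + 0 + x2 + 0 + ((t - a1) / 2) *: 0 + ((t - a3) / 2) *: 0)
  (t *: 0 + 0 + 0 + x3 + ((t - a1) / 2) *: 0 + ((t - a3) / 2) *: 0)); last by [].
by apply: h1_eq; rewrite ?oct0_simp // /t; field.
Qed.

Lemma F4_jtr g X : F4 R g -> jtr (g X) = jtr X.
Proof.
move=> Fg; have [r [s eX]] := associator_decomposition X.
(* The trace after [g] is a linear form that kills associators, so only its value 3 at [Jone]
   contributes. *)
have lg : @linear_for R (J1 R) R^o *:%R (@jtr R \o g).
  by move=> k Y Z /=; rewrite (F4_linear Fg) jtr_linear.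
have tr0 A B C : (@jtr R \o g) (assoc2 A B C) = 0 :> R^o.
  by rewrite /= (F4_assoc2 _ _ _ Fg) jtr_assoc2.
apply: etrans (congr1 (@jtr R \o g) eX) _.
apply: etrans (linear_comb0 _ _ _ _ lg _ _ _ _ _) _; try exact: tr0.
rewrite /= (F4_Jone Fg) /Jone jtrE /GRing.scale /=.
by field.
Qed.

Lemma F4_jform g X Y : F4 R g -> jform (g X) (g Y) = jform X Y.
Proof.
by move=> Fg; rewrite !jform_jmul2 -(F4_jmul2 _ _ Fg) (F4_jtr _ Fg).
Qed.

End AutomorphismGroup.

(** * Positivity of the pairing with [E2] *)

Section Positivity.
Variable R : realType.
Implicit Types (g h : J1 R -> J1 R) (X Y Z : J1 R) (x y a : oct R).

Lemma oinner_ge0 x : 0 <= oinner x x.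
Proof. by row8_elim x; rewrite oinner_row8 !addr_ge0 // -expr2 sqr_ge0. Qed.

Lemma oinner_eq0 x : oinner x x = 0 -> x = 0.
Proof.
row8_elim x; rewrite oinner_row8 row8_0 -!expr2 => /eqP.
rewrite !paddr_eq0 ?addr_ge0 ?sqr_ge0 // !sqrf_eq0.
by do 7?[case/andP]; do 8!move=> /eqP ->.
Qed.

(** The plane of [e_0] and [e_1] suffices: [e_0] itself if [y0] vanishes, otherwise the projection
    of [y] to this plane turned by a right angle. *)
Lemma orthogonal_oct y : exists a, 0 < oinner a a /\ oinner y a = 0.
Proof.
have [y0 [y1 [y2 [y3 [y4 [y5 [y6 [y7 ->]]]]]]]] := row8E y.
have [y00|y00] := eqVneq y0 0.
  exists (row8 1 0 0 0 0 0 0 0); rewrite !oinner_row8 y00; split; last by ring.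
  by rewrite !mul0r !addr0 mulr1 ltr01.
exists (row8 (- y1) y0 0 0 0 0 0 0); rewrite !oinner_row8; split; last by ring.
have := sqr_ge0 y1; have : 0 < y0 ^+ 2 by rewrite lt0r sqrf_eq0 y00 sqr_ge0.
rewrite !expr2; lra.
Qed.

Lemma jformC X Y : jform X Y = jform Y X.
Proof. by rewrite !jform_jmul2 jmul2C. Qed.

Lemma jform_Pminus (a1 a2 a3 : R) x1 x2 x3 :
  jform (h1 a1 a2 a3 x1 x2 x3) (Pminus R) = a2 - a1 - 2 * x3 0 0.
Proof.
rewrite /Pminus jformE !oinnero0.
have -> : oinner x3 (oe R 0) = x3 0 0 by row8_elim x3; row8_ring.
by ring.
Qed.

Lemma jform_E2 (a1 a2 a3 : R) x1 x2 x3 :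
  jform (h1 a1 a2 a3 x1 x2 x3) (E2 R) = a2.
Proof. by rewrite /E2 jformE !oinnero0; ring. Qed.

Lemma jform_sqr_Pminus (a1 a2 a3 : R) x1 x2 x3 :
  let X := h1 a1 a2 a3 x1 x2 x3 in
  jform (jmul2 X X) (Pminus R) = 2 * (a1 + a2) * jform X (Pminus R) +
    2 * oinner (x1 - oconj x2) (x1 - oconj x2).
Proof.
cbv zeta; rewrite jmul2E !jform_Pminus; row8_all; rewrite !row8_simp; ring.
Qed.

(* [(P^-|Z) = 0] implies [(P^-|Z^2) >= 0], and this is inherited by [g P^-].
   Take for [Z] the elements [h^1(0,0,0;0,a,0)], with [a] orthogonal to the
   entry [x_2] of [g P^-]. *)
Lemma F4_positive g : F4 R g -> 0 <= jform (g (Pminus R)) (E2 R).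
Proof.
move=> Fg; have [h [Fh gK hK]] := F4_inverse Fg.
have pos Z : jform (g (Pminus R)) Z = 0 -> 0 <= jform (g (Pminus R)) (jmul2 Z Z).
  rewrite !(jformC (g _)) -[Z]hK -(F4_jmul2 _ _ Fg) !(F4_jform _ _ Fg).
  elim/J1P: (h Z) => a1 a2 a3 x1 x2 x3; rewrite jform_sqr_Pminus => ->.
  by rewrite mulr0 add0r mulr_ge0 // oinner_ge0.
have := F4_jtr (Pminus R) Fg; move: pos.
elim/J1P: (g (Pminus R)) => q1 q2 q3 y1 y2 y3 pos.
rewrite {1}/Pminus !jtrE addNr add0r => tr0; rewrite jform_E2.
have [a [a_gt0 y2a]] := orthogonal_oct y2.
have := pos (h1 0 0 0 0 a 0).
have -> : jmul2 (h1 0 0 0 0 a 0) (h1 0 0 0 0 a 0) =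
   h1 (- 2 * oinner a a) 0 (- 2 * oinner a a) 0 0 0 by J1_compute.
(* The pairing with the square is [-2 (a|a) (q1 + q3)], which equals [2 (a|a) q2] because the trace
   of [g P^-] is 0; as [(a|a) > 0], the sign of [q2] follows. *)
rewrite !jformE !oct0_simp y2a => /(_ _).
nra.
Qed.

End Positivity.

Section LinearOperations.
Variables (R : nzRingType) (U V W : lmodType R) (f h : U -> V).

Lemma linear_addf : linear f -> linear h -> linear (f \+ h).
Proof. by move=> lf lh k X Y /=; rewrite lf lh scalerDr addrACA. Qed.

Lemma linear_subf : linear f -> linear h -> linear (f \- h).
Proof. by move=> lf lh k X Y /=; rewrite lf lh scalerBr opprD addrACA. Qed.

End LinearOperations.

Section Derivations.
Variables (R : nzRingType) (V : lmodType R) (B : V -> V -> V).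
Hypotheses (Bl : forall Y, linear (B^~ Y)) (Br : forall X, linear (B X)).
Variables (f h : V -> V).
Hypotheses (Df : forall X Y, f (B X Y) = B (f X) Y + B X (f Y))
  (Dh : forall X Y, h (B X Y) = B (h X) Y + B X (h Y)).

Lemma deriv_addf X Y : (f \+ h) (B X Y) = B ((f \+ h) X) Y + B X ((f \+ h) Y).
Proof.
by rewrite /= (linear_D _ _ (Bl Y)) (linear_D _ _ (Br X)) Df Dh addrACA.
Qed.

Lemma deriv_subf X Y : (f \- h) (B X Y) = B ((f \- h) X) Y + B X ((f \- h) Y).
Proof.
by rewrite /= (linear_B _ _ (Bl Y)) (linear_B _ _ (Br X)) Df Dh opprD addrACA.
Qed.

End Derivations.

(** * The nilpotent group [N^+] and the weight grading *)

Section NilpotentPart.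
Variable R : realType.
Implicit Types (X Y Z : J1 R) (x y p q : oct R).

Definition G x p : J1 R -> J1 R := G1 x \+ G2 p.

Lemma GE x p (a1 a2 a3 : R) x1 x2 x3 : G x p (h1 a1 a2 a3 x1 x2 x3) =
  h1 (- 2 * oinner (oconj x) x2 + 2 * oinner p x3)
     (2 * oinner x x1 - 2 * oinner p x3)
     (2 * oinner (oconj x) x2 - 2 * oinner x x1)
     ((a3 - a2) *: x + oconj (omul (oconj x) x3) - oconj (omul x2 p) - omul p x1)
     ((a3 - a1) *: oconj x - oconj (omul x3 x) - oconj (omul p x1) - omul x2 p)
     (oconj (omul x x2) + oconj (omul x1 (oconj x)) + (a1 - a2) *: p
       + omul p x3 + omul x3 p).
Proof.
have -> : G x p (h1 a1 a2 a3 x1 x2 x3) =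
    At1 x (h1 a1 a2 a3 x1 x2 x3) + At2 (- oconj x) (h1 a1 a2 a3 x1 x2 x3) +
    (At3 (- p) (h1 a1 a2 a3 x1 x2 x3) - delta p (h1 a1 a2 a3 x1 x2 x3)) by [].
rewrite At1E At2E At3E deltaE h1N h1D h1D h1D.
by apply: h1_eq; row8_all; row8_ring.
Qed.

Lemma G_linear x p : linear (G x p).
Proof.
apply: linear_addf; first by apply: linear_addf; [exact: At1_linear | exact: At2_linear].
by apply: linear_subf; [exact: At3_linear | exact: delta_linear].
Qed.

Lemma G_jmul2 x p X Y : p 0 0 = 0 ->
  G x p (jmul2 X Y) = jmul2 (G x p X) Y + jmul2 X (G x p Y).
Proof.
move=> p0; have Bl Z : linear (@jmul2 R ^~ Z).
  by move=> k A B; rewrite 3!(jmul2C _ Z); exact: jmul2_linear.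
have Br := @jmul2_linear R.
apply: (deriv_addf Bl Br).
  by apply: (deriv_addf Bl Br) => A B; [exact: At1_jmul2 | exact: At2_jmul2].
by apply: (deriv_subf Bl Br) => A B; [exact: At3_jmul2 | exact: delta_jmul2].
Qed.

(* The components of [X] of weights -2, -1 and 0 under [At3 1]; on them
   [exp (G x p)] acts by translations. *)
Definition Vc X := jform X (Pminus R).
Definition Vu X : oct R := X.1.1.2 - oconj X.1.2.
Definition Vq X : oct R := X.2 - (X.2 0 0) *: oe R 0.

(** Weights only go up under [G x p], so nothing arrives in the lowest weight -2. *)
Lemma Vc_G x p X : p 0 0 = 0 -> Vc (G x p X) = 0.
Proof.
move=> p0; elim/J1P: X => a1 a2 a3 x1 x2 x3; rewrite /Vc GE jform_Pminus.
move: p0; row8_elim p; rewrite row8_re => ->.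
by row8_elim x; row8_elim x1; row8_elim x2; row8_elim x3; row8_ring.
Qed.

(** Weight count: weight -1 is reached only from weight -2, through [x]. Likewise, in [Vq_G], weight
    0 is reached from weight -2 through [p] and from weight -1 through [x]. *)
Lemma Vu_G x p X : p 0 0 = 0 -> Vu (G x p X) = - Vc X *: x.
Proof.
move=> p0; elim/J1P: X => a1 a2 a3 x1 x2 x3; rewrite /Vc GE jform_Pminus /Vu /h1 /=.
move: p0; row8_elim p; rewrite row8_re => ->.
by row8_elim x; row8_elim x1; row8_elim x2; row8_elim x3; row8_ring.
Qed.

Definition Im_oct x : oct R := x - (x 0 0) *: oe R 0.

Lemma Vq_G x p X : p 0 0 = 0 ->
  Vq (G x p X) = - Vc X *: p - Im_oct (omul (Vu X) (oconj x)).
Proof.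
move=> p0; elim/J1P: X => a1 a2 a3 x1 x2 x3.
rewrite /Vc GE jform_Pminus /Vu /Vq /Im_oct /h1 /=.
move: p0; row8_elim p; rewrite row8_re => ->.
by row8_elim x; row8_elim x1; row8_elim x2; row8_elim x3; row8_ring.
Qed.

(** The elements with weights 1 and 2 only: [y] gives the weight 1 part, and the rest is
    [r *: Pminus R]. *)
Definition V1 y (r : R) : J1 R := h1 (- r) r 0 y (oconj y) (r *: oe R 0).

(** [Vq] sees only the imaginary part of the weight 0 space; the last two hypotheses remove the
    remaining directions [h1 1 1 0 0 0 0] and [h1 0 0 1 0 0 0]. *)
Lemma V1P Z : Vc Z = 0 -> Vu Z = 0 -> Vq Z = 0 -> Z.1.1.1.2 = 0 -> jtr Z = 0 ->
  exists y r, Z = V1 y r.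
Proof.
elim/J1P: Z => a1 a2 a3 x1 x2 x3; rewrite /Vc jform_Pminus jtrE /Vu /Vq /h1 /=.
move=> c0 /subr0_eq -> /subr0_eq -> a30 tr0; exists (oconj x2), (x3 0 0).
rewrite /V1 oconjK; apply: h1_eq => //; move: c0 tr0; rewrite a30; lra.
Qed.

Lemma G_V0 x p X : p 0 0 = 0 -> Vc X = 0 -> Vu X = 0 -> exists y r, G x p X = V1 y r.
Proof.
move=> p0 c0 u0; apply: V1P.
- exact: Vc_G.
- by rewrite Vu_G // c0 oppr0 scale0r.
- by rewrite Vq_G // c0 u0 omul0o /Im_oct mxE oppr0 !scale0r !subr0.
- move: u0; elim/J1P: X {c0} => a1 a2 a3 x1 x2 x3; rewrite GE /Vu /h1 /=.
  by move/subr0_eq => ->; row8_elim x; row8_elim x2; row8_ring.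
- by elim/J1P: X {c0 u0} => a1 a2 a3 x1 x2 x3; rewrite GE jtrE; ring.
Qed.

Lemma G_V1 x p y r : p 0 0 = 0 -> G x p (V1 y r) = V1 0 (2 * oinner x y).
Proof.
move=> p0; rewrite /V1 GE.
move: p0; row8_elim p; rewrite row8_re => ->.
by row8_elim x; row8_elim y; apply: h1_eq; row8_ring.
Qed.

End NilpotentPart.

Lemma mem_ImO (R : realType) (p : oct R) : (p \in ImO R) = (p 0 0 == 0).
Proof.
apply/idP/eqP => [|p0].
  rewrite /ImO; set s := (X in <<X>>%VS) => /(@coord_span _ _ _ (in_tuple s)) ->.
  rewrite summxE big1 // => i _; rewrite mxE.
  have /mapP[j] : tnth (in_tuple s) i \in s by apply: mem_tnth.
  rewrite mem_enum inE => j0; rewrite (tnth_nth 0) /= => ->.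
  by rewrite mxE eqxx /= eq_sym (negPf j0) mulr0.
rewrite [p]row_sum_delta; apply: memv_suml => i _.
have [->|i0] := eqVneq i ord0; first by rewrite p0 scale0r mem0v.
by apply: memvZ; apply: memv_span; apply/mapP; exists i; rewrite ?mem_enum ?inE.
Qed.

Section NilpotentExp.
Variables (K : numFieldType) (V : lmodType K) (D D' : V -> V).
Hypotheses (lD : linear D) (D'E : forall X, D' X = - D X)
  (D5 : forall X, iter 5 D X = 0).

Lemma texp_linear m : linear (texp D m).
Proof.
have iterP n k X Y : iter n D (k *: X + Y) = k *: iter n D X + iter n D Y.
  by elim: n => //= n ->; rewrite lD.
move=> k X Y; rewrite /texp scaler_sumr -big_split /=; apply: eq_bigr => i _.
by rewrite iterP scalerDr !scalerA [_ * k]mulrC.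
Qed.

Lemma texp5E (T : V -> V) X : texp T 5 X =
  X + T X + 2^-1 *: T (T X) + 6^-1 *: T (T (T X)) + 24^-1 *: T (T (T (T X))).
Proof.
rewrite /texp !big_ord_recl big_ord0 /= addr0 !addrA.
by rewrite !factS fact0 /= !invr1 !scale1r.
Qed.

(** [exp(-D) exp(D)] is multiplied out, all powers of [D] from the fifth on being zero. *)
Lemma texpK : cancel (texp D 5) (texp D' 5).
Proof.
move=> X; have D0 := linear_0 lD.
have DD A B : D (A + B) = D A + D B by rewrite (linear_D _ _ lD).
have DZ k A : D (k *: A) = k *: D A by rewrite (linear_Z _ _ lD).
rewrite (texp5E D') !D'E !(linear_N _ lD) !opprK (texp5E D).
move: (D5 X) => /=; move E1 : (D X) => X1; move E2 : (D X1) => X2.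
move E3 : (D X2) => X3; move E4 : (D X3) => X4 X5.
rewrite !(DD, DZ, E1, E2, E3, E4, X5, scaler0, addr0).
rewrite !(D0, scaler0, addr0) !opprD !scalerDr !scalerN !scalerA !addrA.
(* The fifteen surviving terms are grouped by their degree [k] in [D]; for [k > 0] the coefficients
   sum to [(1 - 1)^k / k! = 0]. *)
rewrite [LHS](ACl (1*(2*6)*(3*7*10)*(4*8*11*13)*(5*9*12*14*15)))%AC /=.
rewrite -[- X2]scaleN1r -!scaleNr -!scalerDl.
rewrite (_ : 2^-1 - 1 + 2^-1 = 0); last by field.
rewrite (_ : 6^-1 - 2^-1 + 2^-1 - 6^-1 = 0); last by field.
rewrite subrr !scale0r !addr0. rewrite (_ : 24^-1 - _ + _ - _ + _ = 0); last by field.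
by rewrite scale0r addr0.
Qed.
End NilpotentExp.

Section ExpG.
Variable R : realType.
Implicit Types (X Y Z : J1 R) (x y p q : oct R).

(** There are five weights and each application raises them. Two applications leave weights at least
    0, the third gives a [V1 y r], the fourth a multiple of [Pminus], the fifth 0. *)
Lemma G_nilpotent x p X : p 0 0 = 0 -> iter 5 (G x p) X = 0.
Proof.
move=> p0; set Y := G x p (G x p X); rewrite (_ : iter 5 _ _ = G x p (G x p (G x p Y))) //.
have cY : Vc Y = 0 by exact: Vc_G.
have uY : Vu Y = 0 by rewrite /Y Vu_G // Vc_G // oppr0 scale0r.
clearbody Y; have [y [r GY]] := G_V0 x p0 cY uY; rewrite GY.
rewrite !(G_V1 _ _ _ p0) oinnero0 mulr0 /V1 oppr0 oconj0 scale0r.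
by [].
Qed.

Lemma expG x p X : p 0 0 = 0 -> expJ (G x p) X = texp (G x p) 5 X.
Proof.
move=> p0; apply: exp_toE; apply: exp_to_nilpotent; last exact: G_nilpotent.
exact: linear_0 (G_linear x p).
Qed.

Lemma GN x p X : G (- x) (- p) X = - G x p X.
Proof.
elim/J1P: X => a1 a2 a3 x1 x2 x3; rewrite !GE h1N.
by apply: h1_eq; row8_all; row8_ring.
Qed.

Lemma im_oppr p : p 0 0 = 0 -> (- p) 0 0 = 0.
Proof. by rewrite mxE => ->; rewrite oppr0. Qed.

Lemma expGK x p : p 0 0 = 0 -> cancel (expJ (G x p)) (expJ (G (- x) (- p))).
Proof.
move=> p0 X; rewrite !expG ?im_oppr //; apply: (texpK (G_linear x p) (GN x p)).
by move=> Y; exact: G_nilpotent.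
Qed.

Lemma expG_F4 x p : p 0 0 = 0 -> F4 R (expJ (G x p)).
Proof.
move=> p0; have eE : expJ (G x p) = texp (G x p) 5.
  by apply/funext => X; exact: expG.
apply: (F4_intro _ (expGK x p0)).
- by rewrite eE; apply: texp_linear; exact: G_linear.
- by have := expGK (- x) (im_oppr p0); rewrite !opprK.
move=> X Y.
(* The product formula [texp_mul] needs ten terms on the product side; those from the fifth on are
   zero, so the exponential is also this longer sum. *)
have -> : expJ (G x p) (jmul2 X Y) = texp (G x p) (5 + 5) (jmul2 X Y).
  apply: exp_toE; apply: exp_to_nilpotent; first exact: linear_0 (G_linear x p).
  rewrite iterD !(G_nilpotent _ _ p0).
  by [].
rewrite eE; apply: texp_mul.
- by move=> Z k A B; rewrite 3!(jmul2C _ Z); exact: jmul2_linear.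
- exact: jmul2_linear.
- exact: G_linear.
- by move=> A B; exact: G_jmul2.
- exact: G_nilpotent.
- exact: G_nilpotent.
- exact: linear_0 (G_linear x p).
- exact: linear_0 (G_linear x p).
Qed.

Lemma Nplus_F4 n : Nplus R n -> F4 R n.
Proof.
move=> [x _ [p /= ]]; rewrite mem_ImO => /eqP p0 <-; exact: expG_F4.
Qed.

Lemma Nplus_expG x p : p 0 0 = 0 -> Nplus R (expJ (G x p)).
Proof.
by move=> p0; exists x => //; exists p => //=; rewrite mem_ImO p0.
Qed.

Lemma expG_fixed x p X : p 0 0 = 0 -> G x p X = 0 -> expJ (G x p) X = X.
Proof.
move=> p0 GX; rewrite expG // texp5E GX.
by rewrite !(linear_0 (G_linear x p)) !scaler0 !addr0.
Qed.

Lemma Nplus_Pminus n : Nplus R n -> n (Pminus R) = Pminus R.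
Proof.
move=> [x _ [p /= ]]; rewrite mem_ImO => /eqP p0 <-; apply: (expG_fixed p0).
have -> : Pminus R = V1 0 1 by rewrite /V1 oconj0 scale1r.
by rewrite (G_V1 _ _ _ p0) oinnero0 mulr0 /V1 oppr0 oconj0 scale0r.
Qed.

(** [E_3] has weight 0, so the series stops after the second power, which contributes [(x|x)] times
    [Pminus]. This is the normal form that the null idempotents are matched with. *)
Lemma expG_E3 x : expJ (G x 0) (h1 0 0 1 0 0 0) =
  h1 (- oinner x x) (oinner x x) 1 x (oconj x) (oinner x x *: oe R 0).
Proof.
have z0 : (0 : oct R) 0 0 = 0 by rewrite mxE.
have e1 : G x 0 (h1 0 0 1 0 0 0) = V1 x 0.
  rewrite GE /V1; apply: h1_eq; rewrite ?oct0_simp ?subr0 ?addr0 ?scale1r //; ring.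
rewrite expG // texp5E e1 !(G_V1 _ _ _ z0) !oinnero0 mulr0.
rewrite /V1 oconj0 !h1Z.
transitivity (h1 (0 - 0 + 2^-1 * (- (2 * oinner x x)) + 6^-1 * - 0 + 24^-1 * - 0)
  (0 + 0 + 2^-1 * (2 * oinner x x) + 6^-1 * 0 + 24^-1 * 0)
  (1 + 0 + 2^-1 * 0 + 6^-1 * 0 + 24^-1 * 0)
  (0 + x + 2^-1 *: 0 + 6^-1 *: 0 + 24^-1 *: 0)
  (0 + oconj x + 2^-1 *: 0 + 6^-1 *: 0 + 24^-1 *: 0)
  (0 + 0 *: oe R 0 + 2^-1 *: ((2 * oinner x x) *: oe R 0) + 6^-1 *: (0 *: oe R 0)
    + 24^-1 *: (0 *: oe R 0))); first by [].
apply: h1_eq; rewrite ?scale0r ?scaler0 ?scalerA ?add0r ?addr0 //; try by field.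
by congr (_ *: _); field.
Qed.

End ExpG.

(** * Diagonalisable derivations and the group [A] *)

Section SpectralExponential.
Variables (K : comNzRingType) (V : lmodType K) (B : V -> V -> V).
Hypotheses (Bl : forall Y, linear (B^~ Y)) (Br : forall X, linear (B X)).
Variables (D : V -> V).
Hypothesis Dleibniz : forall X Y, D (B X Y) = B (D X) Y + B X (D Y).
Variables (e : K -> K) (E : V -> V).
Hypotheses (eD : forall l m, e (l + m) = e l * e m) (lE : linear E)
  (E_eigen : forall l X, D X = l *: X -> E X = e l *: X).

Definition spectral (F : V -> V) X := exists (n : nat) (l : 'I_n -> K) (Z : 'I_n -> V),
  (forall i, F (Z i) = l i *: Z i) /\ X = \sum_i Z i.

(** By the Leibniz rule the product of eigenvectors for [l] and [k] is an eigenvector for [l + k],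
    and [e] turns this sum into a product. Bilinearity does the rest, with no product of series. *)
Lemma spectral_mul X Y : spectral D X -> spectral D Y -> E (B X Y) = B (E X) (E Y).
Proof.
move=> [n [l [Z [DZ ->]]]] [m [k [W [DW ->]]]].
rewrite !(linear_sum _ _ _ lE).
rewrite (linear_sum _ _ _ (Bl _)) (linear_sum _ _ _ (Bl _)) (linear_sum _ _ _ lE).
apply: eq_bigr => i _.
rewrite (linear_sum _ _ _ (Br _)) (linear_sum _ _ _ (Br _)) (linear_sum _ _ _ lE).
apply: eq_bigr => j _.
rewrite (E_eigen (DZ i)) (E_eigen (DW j)) (linear_Z _ _ (Bl _)) (linear_Z _ _ (Br _)).
rewrite scalerA -eD; apply: E_eigen.
by rewrite Dleibniz DZ DW (linear_Z _ _ (Bl _)) (linear_Z _ _ (Br _)) scalerDl.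
Qed.

Lemma spectral_cancel (e' : K -> K) (E' : V -> V) X : linear E' ->
  (forall l Y, D Y = l *: Y -> E' Y = e' l *: Y) ->
  (forall l, e l * e' l = 1) -> spectral D X -> E' (E X) = X.
Proof.
move=> lE' E'_eigen ee' [n [l [Z [DZ ->]]]].
rewrite (linear_sum _ _ _ lE) (linear_sum _ _ _ lE'); apply: eq_bigr => i _.
by rewrite (E_eigen (DZ i)) (linear_Z _ _ lE') (E'_eigen _ _ (DZ i)) scalerA ee' scale1r.
Qed.

End SpectralExponential.

Section ExpTo.
Variables (R : realType) (V : normedModType R).
Implicit Types (T : V -> V) (X Y : V).

Lemma exp_toZ T k X Y : linear T -> exp_to T X Y -> exp_to T (k *: X) (k *: Y).
Proof.
move=> lT h; rewrite /exp_to.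
have iterP n : iter n T (k *: X) = k *: iter n T X.
  by elim: n => //= n ->; rewrite (linear_Z _ _ lT).
have -> : series (fun n => n`!%:R^-1 *: iter n T (k *: X)) =
    (fun n => k *: series (fun n => n`!%:R^-1 *: iter n T X) n).
  apply/funext => n; rewrite /series /= scaler_sumr; apply: eq_bigr => i _.
  by rewrite iterP !scalerA mulrC.
exact: cvgZl_tmp.
Qed.

Lemma exp_to_spectral T X : linear T -> spectral T X -> exists Y, exp_to T X Y.
Proof.
move=> lT [n [l [Z [TZ ->]]]]; exists (\sum_i expR (l i) *: Z i).
apply: (big_ind2 (exp_to T)) => [|X1 Y1 X2 Y2|i _].
- have T0 : T 0 = (0 : R) *: 0 by rewrite scaler0; exact: linear_0.
  by have := exp_to_eigen lT T0; rewrite scaler0.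
- exact: exp_toD.
- exact: exp_to_eigen.
Qed.

End ExpTo.

Lemma expJ_linear (R : realType) (T : J1 R -> J1 R) : linear T ->
  (forall X, exists Y, exp_to T X Y) -> linear (expJ T).
Proof.
move=> lT ex k X Y; have [X' hX] := ex X; have [Y' hY] := ex Y.
rewrite (exp_toE hX) (exp_toE hY); apply: exp_toE.
by apply: (exp_toD lT) => //; exact: exp_toZ.
Qed.
Section Boosts.
Variable R : realType.
Implicit Types (X Y Z : J1 R) (x y p q : oct R) (t : R).
Local Notation one := (oe R 0).

(** The lowest weight vector, equal to [sigma (Pminus R)]. *)
Definition Pplus : J1 R := h1 (-1) 1 0 0 0 (- one).
Definition E12 : J1 R := h1 1 1 0 0 0 0.

Lemma At3_1E (a1 a2 a3 : R) x1 x2 x3 : At3 one (h1 a1 a2 a3 x1 x2 x3) =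
  h1 (- 2 * x3 0 0) (2 * x3 0 0) 0 (oconj x2) (oconj x1) ((a2 - a1) *: one).
Proof.
rewrite At3E; apply: h1_eq => //; rewrite ?omulo1 ?omul1o //; first 2 last.
- by rewrite opprB.
- by row8_elim x3; row8_ring.
- by row8_elim x3; row8_ring.
Qed.

Lemma At3_Pminus : At3 one (Pminus R) = 2 *: Pminus R.
Proof.
rewrite /Pminus At3_1E h1Z oe0_row8 row8_re oconj0.
by apply: h1_eq; rewrite ?scaler0 ?row8_simp //; try (congr row8); ring.
Qed.

Lemma At3_Pplus : At3 one Pplus = - 2 *: Pplus.
Proof.
rewrite /Pplus At3_1E h1Z oe0_row8 oppr_row8 row8_re oconj0.
by apply: h1_eq; rewrite ?scaler0 ?row8_simp //; try (congr row8); ring.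
Qed.

Lemma At3_E12 : At3 one E12 = 0 *: E12.
Proof.
rewrite /E12 At3_1E h1Z oconj0 mxE.
by apply: h1_eq; rewrite ?scaler0 ?subrr ?scale0r //; ring.
Qed.

Lemma spectral_At3 X : spectral (At3 one) X.
Proof.
elim/J1P: X => a1 a2 a3 x1 x2 x3.
pose r := x3 0 0; pose q := x3 - r *: one.
pose y := 2^-1 *: (x1 + oconj x2); pose z := 2^-1 *: (x1 - oconj x2).
pose k := (a1 + a2) / 2.
(* The coefficients of [Pminus] and [Pplus] have sum [(a2 - a1) / 2] and difference [r]. The
   operator exchanges [x1] and [x2] up to conjugation, so their symmetric part [y] has weight 1 and
   their antisymmetric part [z] weight -1; what remains is killed. *)
exists 5, (fun i => nth 0 [:: 2; -2; 1; -1; 0] i),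
  (fun i => nth 0 [:: ((a2 - a1) / 4 + r / 2) *: Pminus R;
    ((a2 - a1) / 4 - r / 2) *: Pplus; h1 0 0 0 y (oconj y) 0;
    h1 0 0 0 z (- oconj z) 0; h1 k k a3 0 0 q] i); split.
  case=> [[|[|[|[|[|//]]]]] lt_i]; cbn [nth nat_of_ord].
  - by rewrite (linear_Z _ _ (@At3_linear R one)) At3_Pminus !scalerA mulrC.
  - by rewrite (linear_Z _ _ (@At3_linear R one)) At3_Pplus !scalerA mulrC.
  - rewrite At3_1E h1Z mxE oconjK; apply: h1_eq;
      rewrite ?subrr ?scale0r ?scaler0 ?scale1r //; ring.
  - rewrite At3_1E h1Z mxE; apply: h1_eq;
      rewrite ?subrr ?scale0r ?scaler0 ?scaleN1r //;
      try ring; by row8_elim z; row8_ring.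
  - rewrite At3_1E h1Z oconj0 subrr !scale0r.
    have -> : q 0 0 = 0 by rewrite /q /r; row8_elim x3; row8_ring.
    by apply: h1_eq => //; ring.
rewrite !big_ord_recl big_ord0; cbn [nth nat_of_ord lift bump addn].
pose u := (a2 - a1) / 4 + r / 2; pose v := (a2 - a1) / 4 - r / 2.
transitivity (h1 (u * (-1) + (v * (-1) + (0 + (0 + (k + 0)))))
  (u * 1 + (v * 1 + (0 + (0 + (k + 0)))))
  (u * 0 + (v * 0 + (0 + (0 + (a3 + 0)))))
  (u *: 0 + (v *: 0 + (y + (z + (0 + 0)))))
  (u *: 0 + (v *: 0 + (oconj y + (- oconj z + (0 + 0)))))
  (u *: one + (v *: (- one) + (0 + (0 + (q + 0))))));
  last by [].
rewrite !scaler0 ?add0r ?addr0; apply: h1_eq.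
- by rewrite /u /v /k; field.
- by rewrite /u /v /k; field.
- by ring.
- by rewrite /y /z; row8_elim x1; row8_elim x2; rewrite !row8_simp; congr row8; field.
- by rewrite /y /z; row8_elim x1; row8_elim x2; rewrite !row8_simp; congr row8; field.
- by rewrite /u /v /q /r; row8_elim x3; rewrite !row8_simp; congr row8; field.
Qed.

End Boosts.

Section BoostGroup.
Variable R : realType.
Implicit Types (X Y Z : J1 R) (x y p q : oct R) (t l : R).
Local Notation one := (oe R 0).

Definition boost t : J1 R -> J1 R := expJ (t *: At3 one).

Let boost_gen_linear t : linear (t *: At3 one : J1 R -> J1 R).
Proof.
move=> k X Y; rewrite -[LHS]/(t *: At3 one (k *: X + Y)) (At3_linear one).
by rewrite scalerDr !scalerA [t * k]mulrC -scalerA.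
Qed.

Lemma boost_exp_to t X : exists Y, exp_to (t *: At3 one : J1 R -> J1 R) X Y.
Proof.
apply: exp_to_spectral; first exact: boost_gen_linear.
have [n [l [Z [DZ eX]]]] := spectral_At3 X.
exists n, (fun i => t * l i), Z; split=> // i.
by rewrite -scalerA -DZ.
Qed.

Lemma boost_linear t : linear (boost t).
Proof.
by apply: expJ_linear; [exact: boost_gen_linear | exact: boost_exp_to].
Qed.

Lemma boost_eigen t l X : At3 one X = l *: X -> boost t X = expR (t * l) *: X.
Proof.
move=> DX; apply: exp_toE; apply: exp_to_eigen; first exact: boost_gen_linear.
by rewrite -scalerA -DX.
Qed.

Lemma boostK t : cancel (boost t) (boost (- t)).
Proof.
move=> X; apply: (spectral_cancel (boost_linear t) (@boost_eigen t)
  (boost_linear (- t)) (@boost_eigen (- t)) _ (spectral_At3 X)).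
by move=> l; rewrite mulNr -expRD subrr expR0.
Qed.

Lemma boost_F4 t : F4 R (boost t).
Proof.
apply: (F4_intro (boost_linear t) (boostK t)).
  by have := boostK (- t); rewrite opprK.
move=> X Y.
have Bl Z : linear (@jmul2 R ^~ Z).
  by move=> k A B; rewrite 3!(jmul2C _ Z); exact: jmul2_linear.
apply: (spectral_mul Bl (@jmul2_linear R) (@At3_jmul2 R one) _ (boost_linear t)
  (@boost_eigen t) (spectral_At3 X) (spectral_At3 Y)).
by move=> l m; rewrite mulrDr expRD.
Qed.

Lemma Asub_boost t : Asub R (boost t).
Proof. by exists t. Qed.

Lemma AsubP a : Asub R a -> exists t, a = boost t.
Proof. by move=> [t _ <-]; exists t. Qed.

Lemma boost_Pminus t : boost t (Pminus R) = expR (t * 2) *: Pminus R.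
Proof. exact: boost_eigen (At3_Pminus R). Qed.

Lemma Asub_id : Asub R id.
Proof.
exists 0 => //; apply/funext => X.
have e : (0 *: At3 one : J1 R -> J1 R) X = 0 *: X.
  by rewrite -[LHS]/(0 *: At3 one X) !scale0r.
by have := exp_toE (exp_to_eigen (boost_gen_linear 0) e); rewrite expR0 scale1r.
Qed.

End BoostGroup.

(** * The representative [w] of the second piece *)

Section WeylElement.
Variable R : realType.
Implicit Types (X Y Z : J1 R) (x y p q : oct R) (t l : R).
Local Notation one := (oe R 0).

Definition weyl : J1 R -> J1 R := expJ (- (pi / 2) *: At1 one).

Let gen : J1 R -> J1 R := - (pi / 2) *: At1 one.

Let gen_linear : linear gen.
Proof.
move=> k X Y; rewrite -[LHS]/(- (pi / 2) *: At1 one (k *: X + Y)) (At1_linear one).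
by rewrite scalerDr !scalerA [_ * k]mulrC -scalerA.
Qed.

Lemma At1_1E (a1 a2 a3 : R) x1 x2 x3 : At1 one (h1 a1 a2 a3 x1 x2 x3) =
  h1 0 (2 * x1 0 0) (- 2 * x1 0 0) ((a3 - a2) *: one) (- oconj x3) (oconj x2).
Proof.
rewrite At1E; apply: h1_eq => //; rewrite ?omulo1 ?omul1o //.
- by row8_elim x1; row8_ring.
- by row8_elim x1; row8_ring.
- by rewrite opprB.
Qed.

(** [At1 1] kills the summand [A] below and has square -4 on [B] and -1 on [C]. The parameter
    [- pi / 2] therefore turns [B] by a half turn, to [- B], and [C] by a quarter turn. *)
Lemma weylE (a1 a2 a3 : R) x1 x2 x3 : weyl (h1 a1 a2 a3 x1 x2 x3) =
  h1 a1 a3 a2 (- oconj x1) (oconj x3) (- oconj x2).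
Proof.
apply: exp_toE.
pose r := x1 0 0; pose k := (a2 + a3) / 2; pose d := (a2 - a3) / 2.
pose A : J1 R := h1 a1 k k (x1 - r *: one) 0 0.
pose B : J1 R := h1 0 d (- d) (r *: one) 0 0.
pose C : J1 R := h1 0 0 0 0 x2 x3.
have pi0 : (pi : R) != 0 by rewrite gt_eqF // pi_gt0.
have hA : exp_to gen A A.
  have e : gen A = 0 *: A.
    rewrite -[LHS]/(- (pi / 2) *: At1 one A) /A At1_1E oconj0 subrr.
    have -> : (x1 - r *: one) 0 0 = 0 by rewrite /r; row8_elim x1; row8_ring.
    rewrite !h1Z; apply: h1_eq; rewrite ?scale0r ?scaler0 ?oppr0 ?scaler0 //; ring.
  by have := exp_to_eigen gen_linear e; rewrite expR0 scale1r.
have hB : exp_to gen B (- B).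
  have e1 : At1 one B = h1 0 (2 * r) (- 2 * r) (- 2 * d *: one) 0 0.
    rewrite /B At1_1E oconj0; apply: h1_eq; rewrite ?oppr0 //; rewrite ?mxE ?eqxx /=; try ring.
    by congr (_ *: _); ring.
  have e2 : At1 one (At1 one B) = - 4 *: B.
    rewrite e1 At1_1E oconj0 /B h1Z; apply: h1_eq; rewrite ?oppr0 ?scaler0 //;
      rewrite ?mxE ?eqxx /=; try ring.
    by rewrite scalerA; congr (_ *: _); ring.
  have e : gen (gen B) = - pi ^+ 2 *: B.
    rewrite -[LHS]/(- (pi / 2) *: At1 one (- (pi / 2) *: At1 one B)).
    rewrite (linear_Z _ _ (@At1_linear R one)) e2 !scalerA; congr (_ *: _).
    by field.
  have := exp_to_rotation gen_linear pi0 e.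
  by rewrite cospi sinpi mul0r scale0r addr0 scaleN1r.
have hC : exp_to gen C (h1 0 0 0 0 (oconj x3) (- oconj x2)).
  have e1 : At1 one C = h1 0 0 0 0 (- oconj x3) (oconj x2).
    rewrite /C At1_1E subrr scale0r mxE; apply: h1_eq => //; ring.
  have e2 : At1 one (At1 one C) = - C.
    rewrite e1 At1_1E subrr scale0r mxE /C h1N.
    by apply: h1_eq; rewrite ?oconjN ?oconjK ?oppr0 //; ring.
  have pi20 : (pi / 2 : R) != 0 by rewrite mulf_neq0 // invr_neq0 // pnatr_eq0.
  have e : gen (gen C) = - (pi / 2) ^+ 2 *: C.
    rewrite -[LHS]/(- (pi / 2) *: At1 one (- (pi / 2) *: At1 one C)).
    rewrite (linear_Z _ _ (@At1_linear R one)) e2 !scalerN scalerA -scaleNr; congr (_ *: _).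
    by field.
  have := exp_to_rotation gen_linear pi20 e.
  rewrite cos_pihalf sin_pihalf scale0r add0r.
  rewrite -[gen C]/(- (pi / 2) *: At1 one C) scalerA.
  have -> : 1 / (pi / 2) * - (pi / 2) = -1 :> R by rewrite mul1r mulrN mulVf.
  by rewrite scaleN1r e1 h1N opprK !oppr0.
have -> : h1 a1 a2 a3 x1 x2 x3 = A + B + C.
  transitivity (h1 (a1 + 0 + 0) (k + d + 0) (k - d + 0)
    (x1 - r *: one + r *: one + 0) (0 + 0 + x2) (0 + 0 + x3)); last by [].
  apply: h1_eq; rewrite ?subrK ?addr0 ?add0r //; rewrite /k /d; by field.
have -> : h1 a1 a3 a2 (- oconj x1) (oconj x3) (- oconj x2) =
    A + - B + h1 0 0 0 0 (oconj x3) (- oconj x2).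
  transitivity (h1 (a1 - 0 + 0) (k - d + 0) (k - - d + 0)
    (x1 - r *: one - r *: one + 0) (0 - 0 + oconj x3) (0 - 0 - oconj x2)); last by [].
  apply: h1_eq; rewrite ?subrr ?subr0 ?addr0 ?add0r //; rewrite ?/k ?/d; try by field.
  by rewrite /r; row8_elim x1; row8_ring.
exact: (exp_toD gen_linear (exp_toD gen_linear hA hB) hC).
Qed.

Lemma weyl_linear : linear weyl.
Proof.
move=> k X Y; elim/J1P: X => *; elim/J1P: Y => *.
rewrite h1Z h1D !weylE h1Z h1D.
by apply: h1_eq; row8_all; row8_ring.
Qed.

(** Supplies the inverse of [weyl] as its third power. *)
Lemma weyl_iter4 X : weyl (weyl (weyl (weyl X))) = X.
Proof.
elim/J1P: X => *; rewrite !weylE; apply: h1_eq => //;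
by row8_all; row8_ring.
Qed.

Lemma weyl_jmul2 X Y : weyl (jmul2 X Y) = jmul2 (weyl X) (weyl Y).
Proof.
elim/J1P: X => a1 a2 a3 x1 x2 x3; elim/J1P: Y => b1 b2 b3 y1 y2 y3.
rewrite jmul2E !weylE jmul2E; apply: h1_eq.
- by row8_elim x2; row8_elim y2; row8_elim x3; row8_elim y3; row8_ring.
- by row8_elim x2; row8_elim y2; row8_elim x1; row8_elim y1; row8_ring.
- by row8_elim x1; row8_elim y1; row8_elim x3; row8_elim y3; row8_ring.
all: by row8_all; row8_ring.
Qed.

Lemma weyl_F4 : F4 R weyl.
Proof.
by apply: (F4_intro weyl_linear weyl_iter4 _ weyl_jmul2) => X; exact: weyl_iter4.
Qed.

End WeylElement.

(** * Idempotents of trace 1 and the two kinds of orbits *)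

Section Idempotents.
Variable R : realType.
Implicit Types (X Y Z : J1 R) (x y p q : oct R) (t l : R).
Local Notation one := (oe R 0).
Local Notation E3 := (h1 0 0 1 0 0 0).

Definition tr1_idempotent Y := jmul2 Y Y = 2 *: Y /\ jtr Y = 1.

Lemma tr1_idempotent_E2 : tr1_idempotent (E2 R).
Proof.
split; last by rewrite /E2 jtrE; ring.
by rewrite /E2 h1Z; J1_compute.
Qed.

Lemma F4_tr1_idempotent g Y : F4 R g -> tr1_idempotent Y -> tr1_idempotent (g Y).
Proof.
move=> Fg [YY trY]; split; last by rewrite (F4_jtr _ Fg).
by rewrite -(F4_jmul2 _ _ Fg) YY (linear_Z _ _ (F4_linear Fg)).
Qed.

Lemma linear_texp5 (V W : lmodType R) (f : V -> W) A B C D E : linear f ->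
  f C = 0 -> f D = 0 -> f E = 0 ->
  f (A + B + 2^-1 *: C + 6^-1 *: D + 24^-1 *: E) = f A + f B.
Proof.
move=> lf fC fD fE; do 4 rewrite (linear_D _ _ lf).
by rewrite !(linear_Z _ _ lf) fC fD fE !scaler0 !addr0.
Qed.

Lemma Vu_linear : linear (@Vu R).
Proof.
move=> k X Y; elim/J1P: X => a1 a2 a3 x1 x2 x3; elim/J1P: Y => b1 b2 b3 y1 y2 y3.
rewrite h1Z h1D /Vu /h1; cbn [fst snd].
by row8_elim x1; row8_elim x2; row8_elim y1; row8_elim y2; row8_ring.
Qed.

Lemma Vq_linear : linear (@Vq R).
Proof.
move=> k X Y; elim/J1P: X => a1 a2 a3 x1 x2 x3; elim/J1P: Y => b1 b2 b3 y1 y2 y3.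
rewrite h1Z h1D /Vq /h1; cbn [fst snd].
by row8_elim x3; row8_elim y3; row8_ring.
Qed.

Lemma Vc_Nplus n X : Nplus R n -> Vc (n X) = Vc X.
Proof.
by move=> Nn; rewrite /Vc -{1}(Nplus_Pminus Nn) (F4_jform _ _ (Nplus_F4 Nn)).
Qed.

Lemma Vu_expG x p X : p 0 0 = 0 -> Vu (expJ (G x p) X) = Vu X - Vc X *: x.
Proof.
move=> p0; rewrite expG // texp5E.
have u Z : Vu (G x p (G x p Z)) = 0 by rewrite Vu_G // Vc_G // oppr0 scale0r.
apply: etrans (linear_texp5 _ _ Vu_linear _ _ _) _; try exact: u.
by rewrite (Vu_G x X p0) scaleNr.
Qed.

Lemma Vq_expG x p X : p 0 0 = 0 ->
  Vq (expJ (G x p) X) = Vq X - Vc X *: p - Im_oct (omul (Vu X) (oconj x)).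
Proof.
move=> p0; rewrite expG // texp5E.
(* The second-order passage from weight -2 to weight 0 is a multiple of [x conj x], which is real
   and so invisible to [Vq]; only the first-order term of the exponential remains. *)
have Imx k : Im_oct (omul (k *: x) (oconj x)) = 0.
  by rewrite /Im_oct; row8_elim x; row8_ring.
have q Z : Vq (G x p (G x p Z)) = 0.
  by rewrite Vq_G // Vc_G // Vu_G // Imx oppr0 scale0r subr0.
apply: etrans (linear_texp5 _ _ Vq_linear _ _ _) _; try exact: q.
by rewrite (Vq_G x X p0) scaleNr addrA.
Qed.

(** Since [E2] is [2^-1 *: E12 + 4^-1 *: (Pminus + Pplus)], the right side is [boost (- ln c / 2)]
    applied to [E2]. *)
Lemma boosted_E2 Z (c := Vc Z) : tr1_idempotent Z -> Vu Z = 0 -> Vq Z = 0 ->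
  0 < c -> Z = 2^-1 *: E12 R + 4^-1 *: (c^-1 *: Pminus R + c *: Pplus R).
Proof.
rewrite {}/c; elim/J1P: Z => a1 a2 a3 x1 x2 x3 [ZZ tr1].
rewrite /Vu /Vq /h1; cbn [fst snd] => /subr0_eq ex1 /subr0_eq ex3.
move: ZZ tr1; rewrite -/(h1 _ _ _ _ _ _) {}ex1 {}ex3; move: (x3 0 0) x2 => r y.
rewrite /Vc jform_Pminus jtrE jmul2E h1Z => -[e1 e2 e3 e4 e5 e6] tr1.
have -> : (r *: one) 0 0 = r by rewrite mxE oe0_row8 row8_re mulr1.
move: e1 e2 e3 e4 e5 e6.
have -> : oinner (oconj y) (oconj y) = oinner y y by row8_elim y; row8_ring.
have -> : oinner (r *: one) (r *: one) = r ^+ 2 by row8_ring.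
move es: (oinner y y) => s e1 e2 e3 e4 e5 e6 c_gt0.
have {e5} k5 : (a1 + a3 + r - 1) *: y = 0.
  have two0 : (2 : R) != 0 by rewrite pnatr_eq0.
  apply: (scalerI two0); rewrite scaler0 -(subrr (2 *: y)) -{1}e5.
  by row8_elim y; row8_ring.
have {e4} k4 : (a2 + a3 - r - 1) *: y = 0.
  have two0 : (2 : R) != 0 by rewrite pnatr_eq0.
  apply: (scalerI two0); rewrite scaler0 -(subrr (2 *: y)) -{2}[y]oconjK.
  have -> : 2 *: oconj (oconj y) = oconj (2 *: oconj y) by row8_elim y; row8_ring.
  rewrite -e4; by row8_elim y; row8_ring.
(* The difference of [k4] and [k5] has coefficient [a2 - a1 - 2r], which is the positive number
   [c]. *)
have y0 : y = 0.
  have : (a2 - a1 - 2 * r) *: y = 0.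
    rewrite -[RHS](subrr 0) -{1}k4 -k5 -scalerBl; congr (_ *: _); ring.
  by move/eqP; rewrite scaler_eq0 gt_eqF // => /eqP.
have s0 : s = 0 by rewrite -es y0 oinner0o.
have {e6} k6 : (a1 + a2 - 1) * r = 0.
  move/(congr1 (fun x : oct R => x 0 0)): e6; rewrite y0; clear.
  by rewrite !row8_simp => e6; move: e6; lra.
move: e1 e2 e3 c_gt0; rewrite s0 !expr2 => e1 e2 e3 c_gt0.
(* The alternative [a3 = 1] gives [a1 + a2 = 0] and [r = 0], and then idempotency forces [a1 = 0],
   so that [c] would vanish. *)
have a3_0 : a3 = 0.
  have : a3 * (a3 - 1) = 0 by lra.
  move/eqP; rewrite mulf_eq0 subr_eq0 => /orP[/eqP //|/eqP a31].
  have a21 : a2 = - a1 by lra.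
  have r0 : r = 0 by move: k6; rewrite a21; lra.
  move: e1 e2 c_gt0; rewrite r0 a21; nra.
have a21 : a2 = 1 - a1 by lra.
(* [a2 - a1 + 2r] is the coefficient that belongs to [Pminus]; its product with [c] is
   [(1 - 2 a1)^2 - 4 r^2], and [e1] makes this 1. *)
have cV : (a2 - a1 - 2 * r)^-1 = a2 - a1 + 2 * r.
  apply: (mulfI (lt0r_neq0 c_gt0)); rewrite divff ?lt0r_neq0 //.
  by move: e1; rewrite a21; lra.
rewrite cV y0 a3_0 oconj0 /E12 /Pminus /Pplus.
set c := a2 - a1 - 2 * r; set d := a2 - a1 + 2 * r.
transitivity (h1 (2^-1 * 1 + 4^-1 * (d * (-1) + c * (-1)))
  (2^-1 * 1 + 4^-1 * (d * 1 + c * 1)) (2^-1 * 0 + 4^-1 * (d * 0 + c * 0))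
  (2^-1 *: 0 + 4^-1 *: (d *: 0 + c *: 0)) (2^-1 *: 0 + 4^-1 *: (d *: 0 + c *: 0))
  (2^-1 *: 0 + 4^-1 *: (d *: one + c *: (- one)))); last by [].
apply: h1_eq; rewrite ?(scaler0, addr0) //; rewrite ?/c ?/d ?a21; try by field.
by rewrite row8_simp; rewrite !row8_simp; congr row8; field.
Qed.

Lemma conjugate_to_E2 Y : tr1_idempotent Y -> 0 < Vc Y ->
  exists n t, Nplus R n /\ boost t (n Y) = E2 R.
Proof.
move=> idY c_gt0; set c := Vc Y in c_gt0.
have c0 := lt0r_neq0 c_gt0.
have p0 : (c^-1 *: Vq Y) 0 0 = 0.
  by rewrite /Vq; move: Y.2 c^-1 => z k; row8_elim z; row8_ring.
(* By [Vu_expG] and [Vq_expG] the parameters [Vu Y / c] and [Vq Y / c] translate both components to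
   0; with this choice of [x] the cross term [Vu Y conj x] is real. The boost [ln c / 2] then
   multiplies the weight 2 and -2 parts by [c] and [c^-1]. *)
have Nn := Nplus_expG (c^-1 *: Vu Y) p0.
set n := expJ _ in Nn; exists n, (ln c / 2); split=> //.
have eq0 : Vq (n Y) = 0.
  rewrite /n Vq_expG // -/c scalerA divff // scale1r subrr sub0r.
  rewrite /Im_oct; move: (Vu Y) c^-1 => z k; by row8_elim z; row8_ring.
have eu0 : Vu (n Y) = 0.
  by rewrite /n Vu_expG // -/c scalerA divff // scale1r subrr.
have := boosted_E2 (F4_tr1_idempotent (Nplus_F4 Nn) idY) eu0 eq0.
rewrite (Vc_Nplus _ Nn) -/c => /(_ c_gt0) ->.
have lb := boost_linear (ln c / 2).
rewrite (linear_D _ _ lb) (linear_Z _ (E12 R) lb) (linear_Z 4^-1 _ lb).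
rewrite (linear_D (c^-1 *: Pminus R) _ lb) (linear_Z _ (Pminus R) lb) (linear_Z _ (Pplus R) lb).
rewrite (boost_eigen _ (At3_E12 R)) (boost_eigen _ (At3_Pminus R)) (boost_eigen _ (At3_Pplus R)).
rewrite mulr0 expR0 divfK ?pnatr_eq0 // mulrN divfK ?pnatr_eq0 // expRN lnK ?posrE //.
rewrite scale1r !scalerA mulVf // divff // !scale1r.
rewrite /E12 /Pminus /Pplus /E2.
transitivity (h1 (2^-1 * 1 + 4^-1 * (-1 + -1)) (2^-1 * 1 + 4^-1 * (1 + 1) : R) (2^-1 * 0 + 4^-1 * (0 + 0))
  (2^-1 *: 0 + 4^-1 *: (0 + 0)) (2^-1 *: 0 + 4^-1 *: (0 + 0))
  (2^-1 *: 0 + 4^-1 *: (one - one))); first by [].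
by apply: h1_eq; rewrite ?subrr ?(scaler0, addr0) //; field.
Qed.

Lemma null_idempotent Y : tr1_idempotent Y -> Vc Y = 0 ->
  exists x, Y = expJ (G x 0) E3.
Proof.
elim/J1P: Y => a1 a2 a3 x1 x2 x3 [YY tr1] c0.
(* The square of [Y] is again orthogonal to [P^-], so the identity for [(P^-|Y^2)] reduces to the
   vanishing of the norm of [x1 - conj x2]. *)
have u0 : x1 = oconj x2.
  have := jform_sqr_Pminus a1 a2 a3 x1 x2 x3; cbv zeta; rewrite YY => e.
  apply/subr0_eq; apply: oinner_eq0; move: c0 e; rewrite /Vc => c0; rewrite c0 mulr0 add0r.
  by move: c0; rewrite h1Z !jform_Pminus mxE; lra.
exists x1; rewrite expG_E3.
move: YY tr1 c0; rewrite /Vc jform_Pminus jtrE jmul2E h1Z u0; move: x2 {u0} => y.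
have -> : oinner (oconj y) (oconj y) = oinner y y by row8_elim y; row8_ring.
have -> : omul (oconj y) y = oinner y y *: one by row8_elim y; row8_ring.
rewrite oconjK; move es: (oinner y y) => s.
have le_N : (x3 0 0) ^+ 2 <= oinner x3 x3.
  row8_elim x3; rewrite row8_re oinner_row8 -!expr2 -!addrA lerDl.
  by rewrite !addr_ge0 ?sqr_ge0.
move=> -[e1 e2 e3 _ _ e6] tr1 c0.
have {e6} k6 : (a1 + a2 - 1) *: x3 + s *: one = 0.
  have two0 : (2 : R) != 0 by rewrite pnatr_eq0.
  apply: (scalerI two0); rewrite scaler0 -(subrr (2 *: x3)) -{1}e6.
  by row8_elim x3; row8_ring.
(* If [a3 = 0], then [a1 + a2 = 1], [s = 0] and the real part of [x3] is [1/2 - a1]. But [e1] gives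
   [(x3|x3) = a1^2 - a1], smaller by 1/4 than the square of that real part, against [le_N]. *)
have a31 : a3 = 1.
  have : a3 * (a3 - 1) = 0 by lra.
  move/eqP; rewrite mulf_eq0 subr_eq0 => /orP[/eqP a30|/eqP //].
  have s0 : s = 0.
    move/(congr1 (fun x : oct R => x 0 0)): k6.
    rewrite (_ : a1 + a2 - 1 = 0) ?scale0r ?add0r; last by lra.
    by rewrite !row8_simp mulr1.
  have r_def : x3 0 0 = 2^-1 - a1 by lra.
  move: e1 le_N; rewrite r_def s0 expr2; nra.
have ex3 : x3 = s *: one.
  move: k6; rewrite (_ : a1 + a2 - 1 = -1); last by lra.
  by rewrite scaleN1r addrC => /subr0_eq.
have r_def : x3 0 0 = s by rewrite ex3 !row8_simp mulr1.
by apply: h1_eq => //; lra.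
Qed.

(** [m] commutes with [At3 1], so it preserves the eigenspace for 2, which is the line of [P^-].
    Commuting with [sigma] gives the same factor [l] on [sigma P^-], and [(P^- | sigma P^-) = 4]
    yields [l^2 = 1]; [F4_positive] excludes [l = -1]. *)
Lemma Msub_Pminus m : Msub R m -> F4 R m /\ m (Pminus R) = Pminus R.
Proof.
move=> [[Fm sm] [k [mK kK mT]]]; split=> //.
have comm X : At3 one (m X) = m (At3 one X).
  by rewrite -[in LHS]mT /= mK.
have [l eP] : exists l, m (Pminus R) = l *: Pminus R.
  have : At3 one (m (Pminus R)) = 2 *: m (Pminus R).
    by rewrite comm At3_Pminus (linear_Z _ _ (F4_linear Fm)).
  elim/J1P: (m (Pminus R)) => a1 a2 a3 x1 x2 x3; rewrite At3_1E h1Z => -[e1 e2 e3 e4 e5 e6].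
  exists a2; rewrite /Pminus h1Z.
  have x10 : x1 = 0.
    have e : 4 *: x1 = x1.
      rewrite -{2}[x1]oconjK e5 (_ : oconj (2 *: x2) = 2 *: oconj x2).
        by rewrite e4 scalerA; congr (_ *: _); ring.
      by row8_elim x2; row8_ring.
    have : (4 - 1) *: x1 = 0 by rewrite scalerBl e scale1r subrr.
    rewrite (_ : 4 - 1 = 3%:R); last by ring.
    by move/eqP; rewrite scaler_eq0 pnatr_eq0 => /eqP.
  have x20 : x2 = 0.
    apply/eqP; move/esym/eqP: e5; rewrite x10 oconj0 scaler_eq0 pnatr_eq0.
    by [].
  have ex3 : x3 = a2 *: one.
    have two0 : (2 : R) != 0 by rewrite pnatr_eq0.
    by apply: (scalerI two0); rewrite -e6 scalerA; congr (_ *: _); lra.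
  by apply: h1_eq; rewrite ?scaler0 //; lra.
have sP : m (sigma (Pminus R)) = l *: sigma (Pminus R).
  have sigmaK X : sigma (sigma X) = X.
    by elim/J1P: X => a1 a2 a3 x1 x2 x3; rewrite !sigmaE !opprK.
  have -> : m (sigma (Pminus R)) = sigma (m (Pminus R)).
    have <- : sigma (m (sigma (sigma (Pminus R)))) = m (sigma (Pminus R)).
      exact: (congr1 (fun f => f (sigma (Pminus R))) sm).
    by rewrite sigmaK.
  rewrite eP /Pminus sigmaE !h1Z sigmaE.
  by apply: h1_eq; rewrite ?scalerN.
have l_ge0 : 0 <= l.
  have := F4_positive Fm; rewrite eP /Pminus h1Z jform_E2; lra.
have l2 : l ^+ 2 = 1.
  have := F4_jform (Pminus R) (sigma (Pminus R)) Fm; rewrite eP sP.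
  rewrite /Pminus sigmaE !h1Z !jformE oppr0 scaler0 !oinnero0 !oe0_row8 !row8_simp expr2.
  lra.
have l1 : l = 1 by move/eqP: l2; rewrite sqrp_eq1 // => /eqP.
by rewrite eP l1 scale1r.
Qed.

Lemma Msub_id : Msub R id.
Proof.
split; last by exists id; split.
split; first exact: F4_id.
apply/funext => X /=; elim/J1P: X => a1 a2 a3 x1 x2 x3.
by rewrite !sigmaE !opprK.
Qed.

Lemma Keps_jform k Z : Keps R k -> jform (k Z) (E2 R) = jform Z (E2 R).
Proof. by move=> [Fk kE]; rewrite -{1}kE (F4_jform _ _ Fk). Qed.

Lemma MAN_Pminus m a n : Msub R m -> Asub R a -> Nplus R n ->
  exists2 r : R, 0 < r & m (a (n (Pminus R))) = r *: Pminus R.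
Proof.
move=> /Msub_Pminus[Fm mP] /AsubP[t ->] Nn; exists (expR (t * 2)); first exact: expR_gt0.
by rewrite (Nplus_Pminus Nn) boost_Pminus (linear_Z _ _ (F4_linear Fm)) mP.
Qed.

Lemma Keps_F4 k : Keps R k -> F4 R k.
Proof. by case. Qed.

Lemma Asub_F4 a : Asub R a -> F4 R a.
Proof. by move/AsubP => [t ->]; exact: boost_F4. Qed.

Lemma Msub_F4 m : Msub R m -> F4 R m.
Proof. by move/Msub_Pminus => []. Qed.

Lemma jform_Z r X Y : jform (r *: X) Y = r * jform X Y.
Proof.
elim/J1P: X => a1 a2 a3 x1 x2 x3; elim/J1P: Y => b1 b2 b3 y1 y2 y3.
rewrite h1Z !jformE !(oinnerC (r *: _)).
have oZ x y : oinner x (r *: y) = r * oinner x y.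
  by have := oinnerP x r y 0; rewrite addr0 oinnero0 addr0.
by rewrite !oZ !(oinnerC _ x1) !(oinnerC _ x2) !(oinnerC _ x3); ring.
Qed.

Lemma jform_Pminus_E2 : jform (Pminus R) (E2 R) = 1.
Proof. exact: jform_E2. Qed.

Lemma jform_weyl_Pminus_E2 : jform (weyl (Pminus R)) (E2 R) = 0.
Proof. by rewrite /Pminus weylE jform_E2. Qed.

Lemma jform_Pminus_inverse g h : F4 R g -> cancel h g ->
  jform (g (Pminus R)) (E2 R) = Vc (h (E2 R)).
Proof.
by move=> Fg hK; rewrite -[in LHS](hK (E2 R)) (F4_jform _ _ Fg) /Vc jformC.
Qed.

(** Once [boost t \o n] carries [g^-1 E_2] to [E_2], composing [g] with its inverse fixes [E_2],
    which gives the factor in [K_eps]. *)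
Lemma open_orbit g : F4 R g -> 0 < jform (g (Pminus R)) (E2 R) ->
  exists k a n, [/\ Keps R k, Asub R a, Nplus R n & g = k \o a \o n].
Proof.
move=> Fg; have [h [Fh gK hK]] := F4_inverse Fg.
rewrite (jform_Pminus_inverse Fg hK) => c_gt0.
have [n [t [Nn anE]]] := conjugate_to_E2 (F4_tr1_idempotent Fh tr1_idempotent_E2) c_gt0.
have Fan := F4_comp (boost_F4 t) (Nplus_F4 Nn).
have [b [Fb anK bK]] := F4_inverse Fan.
exists (g \o b), (boost t), n; split; [|exact: Asub_boost|exact: Nn|].
- split; first exact: F4_comp Fg Fb.
  by rewrite /= -anE -[boost t _]/((boost t \o n) (h (E2 R))) anK hK.
- by apply/funext => X; rewrite /= -[boost t _]/((boost t \o n) X) anK.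
Qed.

(** [g^-1 E_2] is [exp (G x 0) E_3], so [exp (G (- x) (- 0))] followed by [weyl] carries it through
    [E_3] to [E_2]; the factor in [K_eps] then arises as in [open_orbit]. *)
Lemma closed_orbit g : F4 R g -> jform (g (Pminus R)) (E2 R) = 0 ->
  exists k n, [/\ Keps R k, Nplus R n & g = k \o @weyl R \o n].
Proof.
move=> Fg; have [h [Fh gK hK]] := F4_inverse Fg.
rewrite (jform_Pminus_inverse Fg hK) => c0.
have [x hE] := null_idempotent (F4_tr1_idempotent Fh tr1_idempotent_E2) c0.
have z0 : (0 : oct R) 0 0 = 0 by rewrite mxE.
have Nn := Nplus_expG x z0; set n := expJ _ in hE Nn.
have Nn' := Nplus_expG (- x) (im_oppr z0).
have nK : cancel n (expJ (G (- x) (- 0))) by exact: expGK.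
set n' := expJ _ in Nn' nK.
have Fwn := F4_comp (weyl_F4 R) (Nplus_F4 Nn').
have [b [Fb wnK bK]] := F4_inverse Fwn.
have wE : @weyl R E3 = E2 R by rewrite weylE !oconj0 oppr0.
exists (g \o b), n'; split; [|exact: Nn'|].
- split; first exact: F4_comp Fg Fb.
  have -> : E2 R = (@weyl R \o n') (h (E2 R)) by rewrite /= hE nK.
  by rewrite /= -[@weyl R _]/((@weyl R \o n') (h (E2 R))) wnK hK /= hE nK wE.
- by apply/funext => X; rewrite /= -[@weyl R _]/((@weyl R \o n') X) wnK.
Qed.

End Idempotents.

Theorem theorem9p8 (R : realType) :
  let KMAN := Keps R <o> Msub R <o> Asub R <o> Nplus R in
  let KexpMAN :=
    Keps R <o> [set expJ (- (pi / 2) *: At1 (oe R 0))]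
      <o> Msub R <o> Asub R <o> Nplus R in
  [/\ F4 R = KMAN `|` KexpMAN,
      KMAN `&` KexpMAN = set0,
      KMAN = Keps R <o> Asub R <o> Nplus R &
      KexpMAN = [set g | F4 R g /\ jform (g (Pminus R)) (E2 R) = 0]].
Proof.
move=> KMAN KexpMAN.
have FMAN m a n : Msub R m -> Asub R a -> Nplus R n -> F4 R (m \o (a \o n)).
  move=> /Msub_F4 Fm /Asub_F4 Fa /Nplus_F4 Fn.
  exact: F4_comp Fm (F4_comp Fa Fn).
have KMAN_pos g : KMAN g -> F4 R g /\ 0 < jform (g (Pminus R)) (E2 R).
  move=> [_ [_ [k Kk [m Mm <-]] [a Aa <-]] [n Nn <-]].
  split; first exact: F4_comp (Keps_F4 Kk) (FMAN _ _ _ Mm Aa Nn).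
  have [r r_gt0 eP] := MAN_Pminus Mm Aa Nn.
  by rewrite /= eP (Keps_jform _ Kk) jform_Z jform_Pminus_E2 mulr1.
have KexpMAN_null g : KexpMAN g -> F4 R g /\ jform (g (Pminus R)) (E2 R) = 0.
  move=> [_ [_ [_ [k Kk [w -> <-]] [m Mm <-]] [a Aa <-]] [n Nn <-]].
  split.
    exact: F4_comp (F4_comp (Keps_F4 Kk) (weyl_F4 R)) (FMAN _ _ _ Mm Aa Nn).
  have [r r_gt0 eP] := MAN_Pminus Mm Aa Nn.
  rewrite /= eP (Keps_jform _ Kk) -[expJ _ _]/(weyl (r *: Pminus R)).
  rewrite (linear_Z _ _ (@weyl_linear R)) jform_Z.
  by rewrite jform_weyl_Pminus_E2 mulr0.
have KAN_KMAN g : (Keps R <o> Asub R <o> Nplus R) g -> KMAN g.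
  move=> [_ [k Kk [a Aa <-]] [n Nn <-]].
  exists (k \o a); last by exists n.
  exists k; last by exists a.
  by exists k => //; exists id; first exact: Msub_id.
have pos_KAN g : F4 R g -> 0 < jform (g (Pminus R)) (E2 R) ->
    (Keps R <o> Asub R <o> Nplus R) g.
  move=> Fg /(open_orbit Fg)[k [a [n [Kk Aa Nn ->]]]].
  by exists (k \o a); [exists k => //; exists a | exists n].
have null_KexpMAN g : F4 R g -> jform (g (Pminus R)) (E2 R) = 0 -> KexpMAN g.
  move=> Fg /(closed_orbit Fg)[k [n [Kk Nn ->]]].
  exists (k \o @weyl R); last by exists n.
  exists (k \o @weyl R); last by exists id; first exact: Asub_id.
  exists (k \o @weyl R); last by exists id; first exact: Msub_id.
  by exists k => //; exists (@weyl R).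
(* The trivial closing step disposes of [set0] and of the two inclusions already available as
   [KAN_KMAN] and [KexpMAN_null]. *)
split; apply/seteqP; split=> // g.
- move=> Fg; have := F4_positive Fg; rewrite le_eqVlt => /orP[/eqP/esym|] c.
    by right; exact: null_KexpMAN.
  by left; apply: KAN_KMAN; exact: pos_KAN.
- by case=> [/KMAN_pos[]|/KexpMAN_null[]].
- by case=> /KMAN_pos[_ +] /KexpMAN_null[_ c0]; rewrite c0 ltxx.
- by move/KMAN_pos => [Fg c_gt0]; exact: pos_KAN.
- by move=> [Fg c0]; exact: null_KexpMAN.
Qed.
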